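(* Let $p$ be a prime and let $G$ be a countably based abelian pro-$p$ group with torsion subgroup $t(G)$. (i) If $t(G)$ is of finite exponent, then $t(G)$ is a closed subgroup of $G$, and $G$ is (topologically isomorphic to a group) of the form $$\prod_{i=1}^{e}(C_{p^{i}})^{\alpha_{i}}\times \mathbb{Z}_{p}^{X}$$ for some $e\in\mathbb{N}$, some sequence $(\alpha_i)$ in $\mathbb{N}\cup\{0,\aleph_0\}$ and some cardinal $X$. (ii) Otherwise, $G$ is isomorphic to $\overline{t(G)}$ as an abstract group, and $\overline{t(G)}$ is (topologically isomorphic to a group) of the form $$\prod_{i\in\mathbb{N}}(C_{p^{i}})^{\alpha_{i}}$$ for some sequence $(\alpha_i)_{i\in\mathbb{N}}$ in $\mathbb{N}\cup\{0,\aleph_0\}$ not tending to $0$.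
   Context: Here $\mathbb{N}=\{1,2,3,\dots\}$. A profinite group is countably based if its identity has a countable neighbourhood basis. $t(G)$ is the subgroup of torsion elements of $G$ and $\overline{t(G)}$ its topological closure in $G$. $C_n$ is the cyclic group of order $n$. For a group $A$ and a cardinal $\alpha$, $A^{\alpha}$ is the unrestricted Cartesian product of $\alpha$ copies of $A$; all products are unrestricted, with the product topology. A sequence of cardinals does not tend to $0$ if infinitely many of its terms are non-zero. ''Isomorphic as an abstract group'' means isomorphic as groups, ignoring topology. *)

(* Defs.v *)
From HB Require Import structures.
From mathcomp Require Import all_boot all_order all_algebra.
From mathcomp Require Import all_classical all_reals all_analysis.

Set Implicit Arguments.
Unset Strict Implicit.
Unset Printing Implicit Defensive.

Import GRing.Theory.

Local Open Scope classical_set_scope.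
Local Open Scope ring_scope.

(** Abelian groups are written additively, so that the identity is [0] and
    [x *+ n] is the n-th power of [x]. *)

Definition subgroup (G : zmodType) (U : set G) : Prop := zmod_closed [in U].

Definition cosets (G : zmodType) (U : set G) : set (set G) :=
  range (fun x : G => [set x + u | u in U]).

Definition torsion (G : zmodType) : set G :=
  [set x | exists2 n : nat, (0 < n)%N & x *+ n = 0].
Arguments torsion : clear implicits.

Definition finite_exponent (G : zmodType) (A : set G) : Prop :=
  exists2 n : nat, (0 < n)%N & forall x, A x -> x *+ n = 0.

Definition countably_based (G : topologicalZmodType) : Prop :=
  exists B : set (set G),
    [/\ countable B,
        forall b, B b -> nbhs (0 : G) b
      & forall V, nbhs (0 : G) V -> exists2 b, B b & b `<=` V].

Definition profinite (G : topologicalZmodType) : Prop :=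
  [/\ compact [set: G], hausdorff_space G & totally_disconnected [set: G]].

(** A pro-p group is a profinite group all of whose open normal subgroups have
    p-power index; normality is automatic here. *)
Definition pro_p (p : nat) (G : topologicalZmodType) : Prop :=
  profinite G /\
  forall U : set G, open U -> subgroup U ->
    exists k : nat, (cosets U #= `I_(p ^ k))%card.

Definition group_iso (G H : zmodType) : Prop :=
  exists f : {additive G -> H}, bijective f.

(** [PreTopologicalZmodule.type] is the type of abelian groups with a topology;
    compatibility of the two is not needed to express this notion. *)
Definition topgroup_iso (G H : PreTopologicalZmodule.type) : Prop :=
  exists (f : {additive G -> H}) (g : H -> G),
    [/\ cancel f g, cancel g f, continuous f & continuous g].

Lemma torsion_subgroup (G : zmodType) : subgroup (torsion G).
Proof.
split=> [|x y]; rewrite ?inE /torsion; first by exists 1%N; rewrite ?mul0rn.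
move=> [m m0 xm0] [n n0 yn0]; exists (m * n)%N; first by rewrite muln_gt0 m0.
by rewrite mulrnBl mulrnA xm0 mul0rn mulnC mulrnA yn0 mul0rn subr0.
Qed.

Lemma closure_subgroup (G : topologicalZmodType) (A : set G) :
  subgroup A -> subgroup (closure A).
Proof.
move=> [A0 AB]; split=> [|x y]; rewrite !inE.
  by apply: subset_closure; rewrite inE in A0.
move=> clx cly V Vxy.
have [[P Q] /= [Px Qy] PQV] := @sub_continuous G (x, y) V Vxy.
have [a [Aa Pa]] := clx _ Px; have [b [Ab Qb]] := cly _ Qy.
exists (a - b); split; last exact: (PQV (a, b)).
by have := AB a b; rewrite !inE; apply.
Qed.

Section TorsionClosure.
Variable G : topologicalZmodType.

Definition torsion_closure : Type := set_type (closure (torsion G)).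

Let torsion_closure_zmod : zmod_closed [in closure (torsion G)].
Proof. exact/closure_subgroup/torsion_subgroup. Qed.

HB.instance Definition _ := SubChoice.on torsion_closure.
HB.instance Definition _ := Topological.on torsion_closure.
HB.instance Definition _ :=
  GRing.SubChoice_isSubZmodule.Build G _ torsion_closure torsion_closure_zmod.
End TorsionClosure.

Section Product.
Variables (I : Type) (T : I -> zmodType).
Implicit Types f g h : prod_topology T.

Let addf f g : prod_topology T := fun i => f i + g i.
Let oppf f : prod_topology T := fun i => - f i.
Let zerof : prod_topology T := fun i => 0.

Let addfA : associative addf.
Proof. by move=> f g h; apply: functional_extensionality_dep => i; apply: addrA. Qed.
Let addfC : commutative addf.
Proof. by move=> f g; apply: functional_extensionality_dep => i; apply: addrC. Qed.
Let add0f : left_id zerof addf.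
Proof. by move=> f; apply: functional_extensionality_dep => i; apply: add0r. Qed.
Let addNf : left_inverse zerof oppf addf.
Proof. by move=> f; apply: functional_extensionality_dep => i; apply: addNr. Qed.

HB.instance Definition _ :=
  GRing.isZmodule.Build (prod_topology T) addfA addfC add0f addNf.
End Product.

HB.instance Definition _ (I : Type) (T : I -> PreTopologicalZmodule.type) :=
  GRing.Zmodule.on (prod_topology T).

HB.instance Definition _ (G H : PreTopologicalZmodule.type) :=
  GRing.Zmodule.on (G * H)%type.

HB.instance Definition _ (G : zmodType) :=
  GRing.Zmodule.copy (discrete_topology G) G.

(** Only meaningful for [1 < n]: ['Z_0] and ['Z_1] are both Z/2. *)
Notation cyclic_group n := (discrete_topology 'Z_n).

(** The p-adic integers, as the inverse limit of the cyclic groups of order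
    p, p^2, p^3, ...: the component of index [n] is the residue mod
    [p ^ n.+1]. *)
Section Padic.
Variable p : nat.

Definition coherent : set (prod_topology (fun n => cyclic_group (p ^ n.+1))) :=
  [set x | forall n, x n = (nat_of_ord (x n.+1))%:R].

Definition padic_int : Type := set_type coherent.

Let reduceB n (a b : 'Z_(p ^ n.+2)) :
  (nat_of_ord (a - b))%:R
  = (nat_of_ord a)%:R - (nat_of_ord b)%:R :> cyclic_group (p ^ n.+1).
Proof.
have dvdq : ((Zp_trunc (p ^ n.+1)).+2 %| (Zp_trunc (p ^ n.+2)).+2)%N.
  case: (ltnP 1 p) => [p1|]; last first.
    by case: p => [|[|//]] _; rewrite ?exp1n ?exp0n.
  have q_gt1 k : (1 < p ^ k.+1)%N by rewrite -[X in (X < _)%N](exp1n k.+1) ltn_exp2r.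
  by rewrite !Zp_cast // dvdn_exp2l.
apply/eqP; rewrite eq_sym subr_eq -natrD.
apply/eqP; rewrite -{1}(subrK b a) !Zp_nat.
by apply: val_inj; rewrite /= modn_dvdm.
Qed.

Let coherent_subgroup : zmod_closed [in coherent].
Proof.
split=> [|x y]; rewrite !inE /coherent /=; first by [].
by move=> cx cy n; rewrite reduceB -cx -cy.
Qed.

HB.instance Definition _ := SubChoice.on padic_int.
HB.instance Definition _ := Topological.on padic_int.
HB.instance Definition _ :=
  GRing.SubChoice_isSubZmodule.Build _ _ padic_int coherent_subgroup.
End Padic.

Inductive countable_cardinal := Finite of nat | Aleph0.

Definition cardinal_type (a : countable_cardinal) : Type :=
  if a is Finite n then 'I_n else nat.

Definition not_tending_to_0 (alpha : nat -> countable_cardinal) : Prop :=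
  infinite_set [set i | alpha i <> Finite 0].

(* Main.v *)
(** The dual A = Hom_cont(G, Q/Z) is a countable abelian p-group, and a
    character of G lies in nA exactly when it kills the n-torsion of G.
    By countability the socle A[p] has a basis x_0, x_1, ... compatible with
    heights: an element is divisible by p^k only if each of its terms
    c_i x_i is.  When the elements of infinite height of A form a p-divisible
    group, dividing each x_n as often as possible yields
    characters which, put together, map G onto a product of cyclic groups
    (x_n of finite height) and of copies of the p-adic integers (x_n of
    infinite height); this map is injective since these characters generate
    A, and surjective by independence and compactness.
    If t(G) is killed by p^n, an element of infinite height is a character
    killing t(G), and such characters are p-divisible; if t(G) is dense,
    only 0 has infinite height.

    For the abstract isomorphism, let T = t(G).  Both G and the closure of T
    are p-adically complete with torsion T.  If T has infinite exponent,
    both quotients by T + p(-) are F_p-spaces of dimension 2^aleph_0: there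
    are infinitely many x_n of height at least k for every k, and prescribing
    the values of these characters along an almost disjoint family of subsets
    of N gives continuum many independent elements.  Matching bases of the
    quotients, the identity of T extends to a subgroup of the product whose
    p-adic closure is the graph of an isomorphism. *)
From HB Require Import structures.
Require Import Defs.
From mathcomp Require Import all_boot all_order all_algebra.
From mathcomp Require Import all_classical all_reals all_analysis.

Set Implicit Arguments.
Unset Strict Implicit.
Unset Printing Implicit Defensive.

Import Order.TTheory GRing.Theory Num.Theory.

Local Open Scope classical_set_scope.
Local Open Scope ring_scope.

(** * Subgroups and the group Q/Z *)

Section Subgroup.
Variables (G : zmodType) (U : set G).
Hypothesis sU : subgroup U.

Lemma subgroup0 : U 0.
Proof. by case: sU => /set_mem. Qed.

Lemma subgroupB x y : U x -> U y -> U (x - y).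
Proof. by case: sU => _ + Ux Uy => /(_ x y (mem_set Ux) (mem_set Uy)) /set_mem. Qed.

Lemma subgroupN x : U x -> U (- x).
Proof. by move=> Ux; rewrite -sub0r; apply: subgroupB => //; apply: subgroup0. Qed.

Lemma subgroupD x y : U x -> U y -> U (x + y).
Proof. by move=> Ux Uy; rewrite -[y]opprK; apply/subgroupB/subgroupN. Qed.

Lemma subgroupMn x n : U x -> U (x *+ n).
Proof.
by move=> Ux; elim: n => [|n IHn]; rewrite ?mulr0n ?mulrS;
  [exact: subgroup0 | exact: subgroupD].
Qed.

Lemma subgroupMz x n : U x -> U (x *~ n).
Proof. by case: n => n Ux; last apply: subgroupN; apply: subgroupMn. Qed.

Lemma subgroup_sum (I : Type) (r : seq I) (P : pred I) (F : I -> G) :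
  (forall i, P i -> U (F i)) -> U (\sum_(i <- r | P i) F i).
Proof.
move=> UF; elim/big_ind: _ => //; [exact: subgroup0 | exact: subgroupD].
Qed.

End Subgroup.

Lemma subgroupP (G : zmodType) (U : set G) :
  U 0 -> (forall x y, U x -> U y -> U (x - y)) -> subgroup U.
Proof.
by move=> U0 UB; split=> [|x y]; rewrite !in_setE //; apply: UB.
Qed.

Definition integral_rat : pred rat := [pred q | q \is a Num.int].

Lemma integral_rat_zmod_closed : zmod_closed integral_rat.
Proof. by split=> [|x y]; rewrite !inE //; apply: rpredB. Qed.

HB.instance Definition _ :=
  GRing.isZmodClosed.Build rat integral_rat integral_rat_zmod_closed.

Definition rat_mod_int : zmodType := Quotient.quot (GRing.ZmodClosed.clone rat integral_rat _).

Definition proj_mod1 (q : rat) : rat_mod_int :=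
  \pi_(Quotient.quot (GRing.ZmodClosed.clone rat integral_rat _))%qT q.

Lemma proj_mod1_zmod : zmod_morphism proj_mod1.
Proof. exact: raddfB. Qed.

HB.instance Definition _ :=
  GRing.isZmodMorphism.Build rat rat_mod_int proj_mod1 proj_mod1_zmod.

Lemma proj_mod1_eq0 q : (proj_mod1 q == 0) = (q \is a Num.int).
Proof.
rewrite -[RHS]/(q \in integral_rat) -[q in RHS]subr0 Quotient.idealrBE.
by rewrite -[(\pi 0)%qT]/(proj_mod1 0) raddf0.
Qed.

Lemma proj_mod1_surj (x : rat_mod_int) : exists q, proj_mod1 q = x.
Proof. by exists (repr x); apply: reprK. Qed.

(** Serves to code characters by finite lists of rationals. *)
Lemma rat_mod_int_countable : exists f : rat_mod_int -> rat, injective f.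
Proof. by exists repr; apply: can_inj reprK. Qed.

Lemma rat_mod_int_div n (x : rat_mod_int) : (0 < n)%N -> exists y, y *+ n = x.
Proof.
move=> n0; have [q <-] := proj_mod1_surj x; exists (proj_mod1 (q / n%:R)).
by rewrite -(raddfMn proj_mod1) -[_ / _ *+ n]mulr_natr divfK // pnatr_eq0 -lt0n.
Qed.

(** For positive [p], the standard generator of the subgroup of Q/Z killed by p^k. *)
Definition unit_fraction (p k : nat) : rat_mod_int := proj_mod1 (p ^ k)%:R^-1.

Section UnitFraction.
Variable p : nat.
Hypothesis p_gt0 : (0 < p)%N.

Lemma unit_fractionS k : unit_fraction p k.+1 *+ p = unit_fraction p k.
Proof.
rewrite /unit_fraction -(raddfMn proj_mod1); congr (proj_mod1 _).
by rewrite -[LHS]mulr_natr expnSr natrM invfM mulfVK // pnatr_eq0 -lt0n.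
Qed.

Lemma unit_fractionMn_eq0 k n :
  (unit_fraction p k *+ n == 0) = (p ^ k %| n)%N.
Proof.
have pk0 : (p ^ k)%:R != 0 :> rat by rewrite pnatr_eq0 -lt0n expn_gt0 p_gt0.
rewrite /unit_fraction -(raddfMn proj_mod1) proj_mod1_eq0.
apply/idP/idP => [/intrP[m]|/dvdnP[m ->]]; last first.
  by rewrite -[X in X \is a _]mulr_natr natrM mulrCA mulVf // mulr1 natr_int.
rewrite -[LHS]mulr_natr => /(congr1 (fun x => (p ^ k)%:R * x)).
rewrite mulrA mulfV // mul1r -[n%:R]/(n%:Z%:~R) -[(p ^ k)%:R]/((p ^ k)%:Z%:~R).
rewrite -intrM => /eqP; rewrite eqr_int => /eqP nE.
have: ((p ^ k)%N%:Z %| n%:Z)%Z by rewrite nE dvdz_mulr.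
by [].
Qed.

Lemma unit_fraction_gen k x :
  x *+ (p ^ k) = 0 -> exists n, x = unit_fraction p k *+ n.
Proof.
have pk0 : (p ^ k)%:R != 0 :> rat by rewrite pnatr_eq0 -lt0n expn_gt0 p_gt0.
have [q <-] := proj_mod1_surj x => /eqP; rewrite -(raddfMn proj_mod1) proj_mod1_eq0.
(* Here [q] is m / p^k for an integer m; the remainder of m modulo p^k serves as a non-negative
   coefficient, and the quotient is an integer, which vanishes in Q/Z. *)
case/intrP => m mE; exists `|(m %% (p ^ k)%:Z)%Z|%N.
apply/eqP; rewrite -subr_eq0 /unit_fraction -(raddfMn proj_mod1) -raddfB proj_mod1_eq0.
apply/intrP; exists (m %/ (p ^ k)%:Z)%Z.
apply: (mulfI pk0); rewrite mulrBr mulr_natl mE -[_^-1 *+ _]mulr_natr mulrA mulfV // mul1r.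
rewrite pmulrn gez0_abs ?modz_ge0 //; last by rewrite eqz_nat -lt0n expn_gt0 p_gt0.
by rewrite -[(p ^ k)%:R]/((p ^ k)%:Z%:~R) -intrM -intrB {1}(divz_eq m (p ^ k)%:Z) addrK mulrC.
Qed.

End UnitFraction.

Lemma pairMn (G H : zmodType) (x : G) (y : H) n : (x, y) *+ n = (x *+ n, y *+ n).
Proof. by elim: n => // n IHn; rewrite !mulrS IHn. Qed.

Lemma pairMz (G H : zmodType) (x : G) (y : H) n : (x, y) *~ n = (x *~ n, y *~ n).
Proof. by case: n => n; rewrite ?NegzE ?mulrNz -!pmulrn pairMn. Qed.

(** * Injectivity of divisible groups *)

Section Extension.
Variables (G Q : zmodType) (R : set (G * Q)).
Hypothesis Qdiv : forall n (y : Q), (0 < n)%N -> exists z, z *+ n = y.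
Hypothesis sR : subgroup R.
Hypothesis R_fun : forall y, R (0, y) -> y = 0.
Hypothesis R_dom : forall g, exists n y, (0 < n)%N /\ R (g *+ n, y).

(** The graph under consideration is [R] joined to [M], not [M] alone: the empty chain, whose union
    is empty, must satisfy the property too. *)
Let partial_hom (M : set (G * Q)) :=
  subgroup (R `|` M) /\ forall y, (R `|` M) (0, y) -> y = 0.

Let partial_hom_bigcup (F : set (set (G * Q))) :
  F `<=` partial_hom -> total_on F subset -> partial_hom (\bigcup_(M in F) M).
Proof.
move=> Fh Ftot.
have [->|/set0P[M0 FM0]] := eqVneq F set0.
  by rewrite bigcup_set0 /partial_hom setU0.
have UE : R `|` \bigcup_(M in F) M = \bigcup_(M in F) (R `|` M).
  apply/seteqP; split=> [x [Rx|[M FM Mx]]|x [M FM [Rx|Mx]]].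
  - by exists M0 => //; left.
  - by exists M => //; right.
  - by left.
  - by right; exists M.
rewrite /partial_hom UE.
split=> [|y [M FM My]]; last by case: (Fh _ FM) => _; apply.
apply: subgroupP => [|x y [M FM Mx] [N FN Ny]].
  by exists M0 => //; have [/subgroup0] := Fh _ FM0.
have [MN|NM] := Ftot _ _ FM FN; [exists N => // | exists M => //].
  by apply: subgroupB => //; [have [] := Fh _ FN|case: Mx; [left|right; apply: MN]].
by apply: subgroupB => //; [have [] := Fh _ FM|case: Ny; [left|right; apply: NM]].
Qed.

(** Baer's argument: a maximal functional relation containing [R] is total. If it missed [g], let d
    > 0 be least with d g in the domain, divide the value at d g by d, and take the quotient as
    value at [g]. *)
Lemma hom_extension :
  exists f : G -> Q, zmod_morphism f /\ forall x y, R (x, y) -> f x = y.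
Proof.
have [A [[sA A_fun] A_max]] := Zorn_bigcup partial_hom_bigcup.
pose M := R `|` A.
have RM x : R x -> M x by left.
have M_total g : exists y, M (g, y).
  apply: contrapT => gM.
  pose D n := `[< (0 < n)%N /\ exists y, M (g *+ n, y) >].
  have Dex : exists n, D n.
    have [n [y [n0 Ry]]] := R_dom g.
    by exists n; apply/asboolP; split=> //; exists y; left.
  case: (ex_minnP Dex) => d /asboolP [d0 [w Mw]] d_min.
  have [v vE] := Qdiv w d0.
  (* Compatibility of the new value [v] with the old ones: by Euclidean division and minimality of
     [d], n g lies in the domain only when d divides n. *)
  have dvd_d (n : int) z : M (g *~ n, z) -> z = v *~ n.
    move=> Mz.
    have dz : d%:Z != 0 by rewrite eqz_nat -lt0n.
    have rd : (n %% d < d)%Z by rewrite ltz_mod.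
    have := divz_eq n d; have := modz_ge0 n dz; move: rd.
    set q := (n %/ d)%Z; case: (n %% d)%Z => // r; rewrite ltz_nat => rd _ nE.
    have Mr : M (g *+ r, z - w *~ q).
      have := subgroupB sA Mz (subgroupMz sA q Mw).
      rewrite pairMz -[_ - _]/(_ - _, _ - _); congr M; congr pair.
      by rewrite /= nE mulrzDr addrC pmulrn -mulrzA [d%:Z * q]mulrC addKr.
    have r0 : r = 0%N.
      apply/eqP; rewrite -leqn0 leqNgt; apply/negP => r0.
      have : (d <= r)%N by apply: d_min; apply/asboolP; split=> //; exists (z - w *~ q).
      by rewrite leqNgt rd.
    move: Mr; rewrite r0 mulr0n => /A_fun /eqP; rewrite subr_eq0 => /eqP ->.
    by rewrite -vE nE r0 addr0 pmulrn -mulrzA mulrC.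
  pose N := [set xy : G * Q | exists u (n : int), M u /\ xy = u + (g, v) *~ n].
  have MN u : M u -> N u.
    by move=> Mu; exists u, 0; rewrite mulr0z addr0.
  have sN : subgroup N.
    apply: subgroupP => [|_ _ [u [n [Mu ->]]] [u' [n' [Mu' ->]]]].
      by apply: MN; apply: subgroup0 sA.
    exists (u - u'), (n - n'); split; first exact: subgroupB.
    by rewrite mulrzBr opprD addrACA.
  have N_fun y : N (0, y) -> y = 0.
    case=> -[x z] [n [Mxz]]; rewrite pairMz => -[/esym/eqP].
    rewrite addr_eq0 => /eqP xE ->.
    have /dvd_d : M (g *~ (- n), z) by rewrite mulrNz -xE.
    by rewrite mulrNz => ->; rewrite addNr.
  have RN : R `|` N = N by apply/setUidPr => u Ru; apply: MN; left.
  apply: (A_max N); last by rewrite /partial_hom RN.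
  rewrite properEneq; split; last by move=> u Au; apply: MN; right.
  apply/eqP => AN; apply: gM; exists v; right; rewrite AN.
  by exists 0, 1; rewrite mulr1z add0r; split=> //; apply: subgroup0 sA.
have M_uniq g y z : M (g, y) -> M (g, z) -> y = z.
  move=> My Mz; apply/eqP; rewrite -subr_eq0; apply/eqP/A_fun.
  by have := subgroupB sA My Mz; rewrite -[_ - _]/(_ - _, _ - _) /= subrr.
have [f fM] := choice M_total; exists f; split=> [x y|x y Rxy].
  by apply: M_uniq (fM _) _; have := subgroupB sA (fM x) (fM y).
by apply: M_uniq (fM _) _; left.
Qed.
End Extension.

(** * Profinite abelian groups *)

(** Finite intersection property for a downward directed family: a cluster point of the filter it
    generates on [K] lies in all its closed members. *)
Lemma compact_filter_base (T : topologicalType) (K : set T) (D : set (set T)) :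
  compact K -> (exists W, D W) ->
  (forall W W', D W -> D W' -> exists2 W'', D W'' & W'' `<=` W `&` W') ->
  (forall W, D W -> closed W) ->
  (forall W, D W -> exists y, K y /\ W y) ->
  exists y, K y /\ forall W, D W -> W y.
Proof.
move=> cK [W0 DW0] DI Dcl DK.
pose F := filter_from D (fun W => W `&` K).
have FF : ProperFilter F.
  apply: filter_from_proper => [|W /DK [y [Ky Wy]]]; last by exists y.
  apply: filter_from_filter => [|W W' DW DW']; first by exists W0.
  have [W'' DW'' sW] := DI _ _ DW DW'; exists W'' => // y [/sW [Wy W'y] Ky].
  by split; split.
have [|y [Ky clFy]] := cK F FF; first by exists W0 => // y [].
exists y; split=> // W DW; apply: (Dcl _ DW) => V Vy.
have [|z [[Wz _] Vz]] := clFy (W `&` K) V _ Vy; first by exists W.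
by exists z.
Qed.

(** * Totally disconnected compact Hausdorff spaces are zero-dimensional *)

Section ZeroDimensional.
Variable T : topologicalType.
Hypotheses (cT : compact [set: T]) (hT : hausdorff_space T).

(** The quasi-component of [x]. The aim is to show that it is connected. *)
Let quasi (x : T) := [set y | forall W, clopen W -> W x -> W y].

Let quasi_closed x : closed (quasi x).
Proof.
move=> y yQ W cW Wx; case: (cW) => _; apply; apply: closure_subset yQ.
by move=> z; apply.
Qed.

(** If every clopen neighbourhood of [x] met the complement of [O], compactness would give a point
    of the quasi-component outside [O]. *)
Let quasi_separation x (O : set T) :
  open O -> quasi x `<=` O -> exists2 W, clopen W /\ W x & W `<=` O.
Proof.
move=> oO QO; apply: contrapT => noW.
have := @compact_filter_base T (~` O) [set W | clopen W /\ W x].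
case.
- by apply: subclosed_compact cT _ => //; apply: open_closedC.
- by exists setT; split=> //; apply: clopenT.
- move=> W W' [cW Wx] [cW' W'x]; exists (W `&` W') => //.
  by split; [apply: clopenI | split].
- by move=> W [[]].
- move=> W [cW Wx]; apply: contrapT => noy; apply: noW; exists W => // y Wy.
  by apply: contrapT => Oy; apply: noy; exists y.
- move=> y [nOy Wy]; apply: nOy; apply: QO => W cW Wx.
  exact: Wy.
Qed.

(** Normality puts the two pieces into disjoint open sets [O] and [O']. A clopen [W] around [x]
    inside their union meets [O] in a clopen set, which must contain the whole quasi-component
    although [P'] lies in [O']. *)
Let quasi_split x (P P' : set T) : closed P -> closed P' -> P x ->
  quasi x = P `|` P' -> P `&` P' = set0 -> P' = set0.
Proof.
move=> clP clP' Px QE dis.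
have PN : set_nbhs P (~` P').
  apply/set_nbhsP; exists (~` P'); split=> //; first exact: closed_openC.
  by apply/disjoints_subset.
have [N PN' clN] := compact_normal hT cT clP PN.
have /set_nbhsP[V [oO PO ON]] := PN'; move: V oO PO ON => O oO PO ON.
pose O' := ~` closure N.
have oO' : open O' by apply/closed_openC/closed_closure.
have OO' : O `&` O' = set0.
  apply/disjoints_subset; rewrite /O' setCK.
  exact: subset_trans ON (@subset_closure _ _).
have P'O' : P' `<=` O' by move=> y P'y /clN; apply.
have [|W [[oW cW] Wx] WO] := @quasi_separation x (O `|` O') (openU oO oO').
  by rewrite QE; apply: setUSS.
have cWO : clopen (W `&` O).
  split; first exact: openI.
  suff -> : W `&` O = W `&` ~` O' by apply: closedI => //; apply: open_closedC.
  apply/seteqP; split=> y [Wy yO]; split=> //.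
    by move=> O'y; have: (O `&` O') y by []; rewrite OO'.
  by case: (WO _ Wy).
apply/seteqP; split=> // y P'y.
have : quasi x y by rewrite QE; right.
move=> /(_ _ cWO) [|_ Oy]; first by split=> //; apply: PO.
by have: (O `&` O') y by [split=> //; apply: P'O']; rewrite OO'.
Qed.

Lemma totally_disconnected_zero_dimensional :
  totally_disconnected [set: T] -> zero_dimensional T.
Proof.
move=> tdT x y xy; apply: contrapT => noU.
have Qy : quasi x y.
  by move=> W cW Wx; apply: contrapT => Wy; apply: noU; exists W.
suff cQ : connected (quasi x).
  have : connected_component setT x y.
    by exists (quasi x) => //; split=> // W.
  by rewrite tdT // => yx; rewrite yx eqxx in xy.
move=> B [b Bb] [C oC BC] [D cD BD].
have clB : closed B by rewrite BD; apply: closedI.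
have clB' : closed (quasi x `&` ~` C).
  by apply: closedI => //; apply: open_closedC.
have QBB' : quasi x = B `|` (quasi x `&` ~` C) by rewrite BC -setIUr setUv setIT.
have BB' : B `&` (quasi x `&` ~` C) = set0.
  by rewrite BC setIACA setICr setI0.
have : quasi x x by [].
rewrite {1}QBB' => -[Bx|B'x].
  by rewrite [RHS]QBB' (quasi_split clB clB' Bx QBB' BB') setU0.
have := quasi_split clB' clB B'x; rewrite [_ `|` B]setUC [_ `&` B]setIC.
move=> /(_ QBB' BB') B0.
by move: Bb; rewrite B0.
Qed.

End ZeroDimensional.

(** * Open subgroups of compact groups *)

Section TopologicalGroup.
Variable G : topologicalZmodType.

Lemma translation_continuous (a : G) : continuous (fun x => x + a).
Proof.
move=> x; apply: (@continuous_comp _ _ _ (fun x => (x, a)) (fun x => x.1 + x.2)).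
  by apply: cvg_pair => /=; [exact: cvg_id|exact: cvg_cst].
exact: add_continuous.
Qed.

Lemma nbhs_translate (V : set G) x : nbhs 0 V -> nbhs x [set y | V (y - x)].
Proof.
by move=> V0; apply: (@translation_continuous (- x)); rewrite subrr.
Qed.

Lemma subgroup_open (U : set G) : subgroup U -> nbhs 0 U -> open U.
Proof.
move=> sU U0; rewrite openE => x Ux.
apply: filterS (nbhs_translate x U0) => y /= Uyx.
by rewrite -[y](subrK x); apply: subgroupD.
Qed.

Lemma topgroup_natmul_continuous n : continuous (fun x : G => x *+ n).
Proof.
elim: n => [|n IHn] x.
  have -> : (fun x : G => x *+ 0) = cst 0 by apply/funext => y; rewrite mulr0n.
  exact: cvg_cst.
have -> : (fun x : G => x *+ n.+1) = (fun x => x + x *+ n).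
  by apply/funext => y; rewrite mulrS.
apply: (@continuous_comp _ _ _ (fun x => (x, x *+ n)) (fun x => x.1 + x.2)).
  by apply: cvg_pair => /=; [exact: cvg_id|exact: IHn].
exact: add_continuous.
Qed.

(** The stabiliser of [W] under translation works: it lies in [W] because [W] contains 0, and
    compactness of [W] makes it a neighbourhood of 0. *)
Lemma clopen_nbhs_subgroup (W : set G) : compact [set: G] ->
  clopen W -> W 0 -> exists U, [/\ subgroup U, nbhs 0 U & U `<=` W].
Proof.
move=> cG [oW cW] W0.
pose U := [set x | forall w, W w -> W (w + x) /\ W (w - x)].
exists U; split.
- apply: subgroupP => [w Ww|x y Ux Uy w Ww]; first by rewrite subr0 addr0.
  have [Wx Wx'] := Ux _ Ww.
  rewrite opprB addrA [w + (y - x)]addrCA [y + _]addrC.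
  by split; [have [] := Uy _ Wx | have [] := Uy _ Wx'].
- have /compact_near_coveringP : compact W by apply: subclosed_compact cG _.
  move=> /(_ _ (nbhs 0) (fun x w => W (w + x) /\ W (w - x)) _); apply.
  move=> w Ww.
  have addW : nbhs (w, 0) [set z : G * G | W (z.1 + z.2)].
    apply: (@add_continuous G (w, 0)); rewrite /= addr0.
    by apply: open_nbhs_nbhs.
  have subW : nbhs (w, 0) [set z : G * G | W (z.1 - z.2)].
    apply: (@sub_continuous G (w, 0)); rewrite /= subr0.
    by apply: open_nbhs_nbhs.
  by apply: filterS (filterI addW subW) => -[].
- by move=> x /(_ _ W0); rewrite add0r => -[].
Qed.

End TopologicalGroup.

(** The working form of a countably based pro-p group: open subgroups are asked to have a quotient
    killed by a power of p, a condition on elements that restricts directly to the closure of the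
    torsion. *)
Definition prop_group (p : nat) (G : topologicalZmodType) : Prop :=
  [/\ compact [set: G], hausdorff_space G,
      forall V : set G, nbhs 0 V -> exists U, [/\ subgroup U, nbhs 0 U, U `<=` V
        & exists k, forall x, U (x *+ p ^ k)]
    & countably_based G].

(* Translation by x permutes the n cosets, so the sum of the representatives
   changes by n x modulo U. *)
Lemma index_mul_subgroup (G : zmodType) (U : set G) n : subgroup U ->
  (cosets U #= `I_n)%card -> forall x, U (x *+ n).
Proof.
move=> sU /card_esym/card_set_bijP [F [/= F1 F2 F3]] x.
have coset_eq a b : U (a - b) ->
    [set a + u | u in U] = [set b + u | u in U].
  move=> Uab; apply/seteqP; split=> _ [u Uu <-].
    by exists (a - b + u); [exact: subgroupD | rewrite addrA [b + _]addrC subrK].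
  exists (u - (a - b)); first exact: subgroupB.
  by rewrite opprB addrCA [a + _]addrC subrK addrC.
have coset_sub a b : [set a + u | u in U] = [set b + u | u in U] -> U (a - b).
  move=> ab; have : [set b + u | u in U] a.
    by rewrite -ab; exists 0; rewrite ?addr0 //; apply: subgroup0.
  by case=> u Uu <-; rewrite addrC addKr.
have /choice[r rE] : forall i : 'I_n, exists g, F i = [set g + u | u in U].
  by move=> i; have [g _ <-] := F1 i (ltn_ord i); exists g.
have /choice[s sE] : forall i : 'I_n, exists j : 'I_n, U (r j - (r i + x)).
  move=> i.
  have [|j jn Fj] := F3 [set r i + x + u | u in U]; first by exists (r i + x).
  by exists (Ordinal jn); apply: coset_sub; rewrite -rE.
have s_inj : injective s.
  move=> i j sij; apply/val_inj/F2; [exact/mem_set/ltn_ord.. | rewrite /= !rE; apply: coset_eq].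
  have := subgroupB sU (sE j) (sE i).
  by rewrite sij opprB addrC subrKA opprD addrACA subrr addr0.
have /subgroupN : U (\sum_i (r (s i) - (r i + x))) by apply: subgroup_sum.
have sumE : \sum_i r (s i) = \sum_i r i by rewrite [RHS](reindex_inj s_inj).
rewrite sumrB big_split /= sumE sumr_const card_ord opprB [_ + x *+ n]addrC addrK.
exact.
Qed.

Lemma pro_p_prop_group p (G : topologicalZmodType) :
  pro_p p G -> countably_based G -> prop_group p G.
Proof.
move=> [[cG hG tdG] idx] cb; split=> // V V0.
have zG := totally_disconnected_zero_dimensional cG hG tdG.
have [W [W0 cW] WV] := zero_dimensional_cvg hG zG cG V0.
have [U [sU U0 UW]] := clopen_nbhs_subgroup cG cW W0.
have [k cardU] := idx U (subgroup_open sU U0) sU.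
exists U; split=> //; first exact: subset_trans UW WV.
by exists k; apply: index_mul_subgroup.
Qed.

(** * The closure of the torsion subgroup as a topological group *)

Section TorsionClosureGroup.
Variable G : topologicalZmodType.
Local Notation t := (torsion_closure G).

Lemma torsion_closure_val_continuous : continuous (val : t -> G).
Proof. exact: initial_continuous. Qed.

Lemma torsion_closure_sub_continuous : continuous (fun x : t * t => x.1 - x.2).
Proof.
apply: continuous_comp_initial => x.
apply: (@continuous_comp _ _ _ (fun x : t * t => (val x.1, val x.2))
  (fun x : G * G => x.1 - x.2)); last exact: sub_continuous.
apply: cvg_pair => /=.
  apply: (@continuous_comp _ _ _ (fst : t * t -> t) (val : t -> G)).
    exact: cvg_fst.
  exact: torsion_closure_val_continuous.
apply: (@continuous_comp _ _ _ (snd : t * t -> t) (val : t -> G)).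
  exact: cvg_snd.
exact: torsion_closure_val_continuous.
Qed.

End TorsionClosureGroup.

HB.instance Definition _ (G : topologicalZmodType) :=
  PreTopologicalNmodule_isTopologicalZmodule.Build (torsion_closure G)
    (@torsion_closure_sub_continuous G).

Section TorsionClosureTheory.
Variable G : topologicalZmodType.
Local Notation t := (torsion_closure G).

Lemma torsion_closure_valB (x y : t) : val (x - y) = val x - val y.
Proof. by []. Qed.

Lemma torsion_closure_valMn (x : t) n : val (x *+ n) = val x *+ n.
Proof. by elim: n => // n IHn; rewrite !mulrS -IHn. Qed.

Lemma torsion_closure_valP (x : t) : closure (torsion G) (val x).
Proof. exact/set_mem/valP. Qed.

Lemma nbhs_torsion_closure_val (x : t) (W : set G) :
  nbhs (val x) W -> nbhs x [set y | W (val y)].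
Proof. by move=> Wx; have := @torsion_closure_val_continuous G x W Wx. Qed.

Lemma torsion_closure_nbhs (x : t) V :
  nbhs x V <-> exists2 W, nbhs (val x) W & forall y : t, W (val y) -> V y.
Proof.
split=> [[_ [[W oW <-] Wx WV]]|[W Wx WV]].
  by exists W; [exact: open_nbhs_nbhs | move=> y; apply: WV].
by apply: filterS (nbhs_torsion_closure_val Wx) => y; apply: WV.
Qed.

Lemma torsion_closure_torsion (x : t) : torsion t x <-> torsion G (val x).
Proof.
split=> [[n n0 xn]|[n n0 xn]]; exists n => //.
  by rewrite -torsion_closure_valMn xn.
by apply: val_inj; rewrite torsion_closure_valMn xn.
Qed.

Lemma torsion_closure_dense : closure (torsion t) = [set: t].
Proof.
apply/seteqP; split=> // x _ V /torsion_closure_nbhs [W Wx WV].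
have [y [Ty Wy]] := torsion_closure_valP Wx.
pose y' : t := SigSub (mem_set (subset_closure Ty)).
by exists y'; split; [exact/torsion_closure_torsion | exact: WV].
Qed.

Lemma prop_group_torsion_closure p : prop_group p G -> prop_group p t.
Proof.
move=> [cG hG bG [B [cB B0 BV]]]; split.
- move=> F FF _.
  have clT : F [set x | closure (torsion G) (val x)].
    by apply: filterS filterT => x _; apply: torsion_closure_valP.
  have [|y [cly Fy]] := @subclosed_compact _ (closure (torsion G)) _
    (@closed_closure _ _) cG _ (val @ F) _ clT; first by [].
  pose y' : t := SigSub (mem_set cly).
  exists y'; split=> // A V FA /torsion_closure_nbhs [W Wy WV].
  have [|_ [[x Ax <-] Wx]] := Fy (val @` A) W _ Wy.
    have : F [set x | (val @` A) (val x)] by apply: filterS FA => x Ax; exists x.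
    exact.
  by exists x; split=> //; apply: WV.
- move=> x y xy; apply/val_inj/hG => V W Vx Wy.
  have [||z [Vz Wz]] := xy [set x : t | V (val x)] [set x : t | W (val x)].
  + exact: nbhs_torsion_closure_val.
  + exact: nbhs_torsion_closure_val.
  by exists (val z).
- move=> V /torsion_closure_nbhs [W W0 WV].
  have [U [sU U0 UW [k Uk]]] := bG W W0; exists [set x : t | U (val x)]; split.
  + apply: subgroupP => [|x y Ux Uy]; first exact: subgroup0 sU.
    have := subgroupB sU Ux Uy; rewrite -torsion_closure_valB; exact.
  + exact: nbhs_torsion_closure_val.
  + by move=> x /UW; apply: WV.
  + by exists k => x; have := Uk (val x); rewrite -torsion_closure_valMn.
exists [set [set x : t | b (val x)] | b in B]; split.
- exact: sub_countable (card_image_le _ _) cB.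
- by move=> _ [b Bb <-]; apply: nbhs_torsion_closure_val; apply: B0.
move=> V /torsion_closure_nbhs [W /BV[b Bb bW] WV].
exists [set x : t | b (val x)]; [by exists b | by move=> x /bW; apply: WV].
Qed.

Lemma torsion_closure_finite_exponent :
  finite_exponent (torsion t) -> finite_exponent (torsion G).
Proof.
move=> [n n0 Tn]; exists n => // x Tx.
pose x' : t := SigSub (mem_set (subset_closure Tx)).
have /Tn /(congr1 val) : torsion t x' by exact/torsion_closure_torsion.
by rewrite torsion_closure_valMn.
Qed.

End TorsionClosureTheory.

(** * Valuated bases of the socle *)

Definition multiples (A : zmodType) (n : nat) : set A :=
  [set a | exists b, b *+ n = a].
Arguments multiples : clear implicits.

Lemma multiples_subgroup (A : zmodType) n : subgroup (multiples A n).
Proof.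
apply: subgroupP => [|_ _ [b <-] [c <-]]; first by exists 0; rewrite mul0rn.
by exists (b - c); rewrite mulrnBl.
Qed.

Lemma multiples_expS (A : zmodType) p k :
  multiples A (p ^ k.+1) `<=` multiples A (p ^ k).
Proof. by move=> _ [b <-]; exists (b *+ p); rewrite -mulrnA -expnS. Qed.

Lemma multiples_exp_leq (A : zmodType) p k l : (k <= l)%N ->
  multiples A (p ^ l) `<=` multiples A (p ^ k).
Proof.
by move=> kl _ [b <-]; exists (b *+ p ^ (l - k)); rewrite -mulrnA -expnD subnK.
Qed.

Section SocleBasis.
Variables (A : zmodType) (p : nat).
Hypothesis p_pr : prime p.

Definition spanned (x : nat -> A) (n : nat) : set A :=
  [set a | exists c : nat -> nat, a = \sum_(i < n) x i *+ c i].

Lemma mulrn_modp (a : A) n : a *+ p = 0 -> a *+ (n %% p) = a *+ n.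
Proof.
move=> ap; rewrite [in RHS](divn_eq n p) mulrnDr mulnC mulrnA ap mul0rn add0r.
by [].
Qed.

Lemma spanned_finite x n : (forall i, (i < n)%N -> x i *+ p = 0) ->
  finite_set (spanned x n).
Proof.
move=> xp; pose F (c : {ffun 'I_n -> 'I_p}) := \sum_(i < n) x i *+ c i.
apply: (@sub_finite_set _ _ (F @` setT)); last exact/finite_image/finite_finset.
move=> _ [c ->]; exists [ffun i : 'I_n => Ordinal (ltn_pmod (c i) (prime_gt0 p_pr))] => //.
by apply: eq_bigr => i _; rewrite ffunE /= mulrn_modp // xp.
Qed.

Lemma spanned_subgroup x n : (forall i, (i < n)%N -> x i *+ p = 0) ->
  subgroup (spanned x n).
Proof.
move=> xp; apply: subgroupP.
  by exists (fun=> 0%N); rewrite big1.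
(* Coefficients are natural numbers; [p.-1] acts as -1 on elements killed by p. *)
move=> _ _ [c ->] [d ->]; exists (fun i => c i + (p.-1 * d i))%N.
rewrite -sumrB; apply: eq_bigr => i _.
rewrite mulrnDr; congr (_ + _); apply/eqP.
rewrite eq_sym -addr_eq0 -mulrnDr -mulSnr prednK ?prime_gt0 //.
by rewrite mulrnA xp // mul0rn.
Qed.

(** The coset of [a] modulo the span is finite. Either it contains an element of infinite height, or
    its heights are bounded and a maximum is attained. *)
Lemma maximal_height x n (a : A) : (forall i, (i < n)%N -> x i *+ p = 0) ->
  exists y, spanned x n (y - a) /\
    forall s k, spanned x n s -> multiples A (p ^ k) (y + s) ->
      multiples A (p ^ k) y.
Proof.
move=> xp; have sS := spanned_subgroup xp.
pose S := [set y | spanned x n (y - a)].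
have [[y Sy yinf]|noinf] :=
  pselect (exists2 y, S y & forall k, multiples A (p ^ k) y).
  by exists y; split=> // s k _ _; apply: yinf.
(* [h y] is an exponent at which divisibility of [y] fails, hence a bound for its height. *)
have /choice[h hP] : forall y, exists k, S y -> ~ multiples A (p ^ k) y.
  move=> y; have [Sy|] := pselect (S y); last by exists 0%N.
  apply: contrapT => yinf; apply: noinf; exists y => // k.
  by apply: contrapT => yk; apply: yinf; exists k.
have [K KP] : exists K, forall y, S y -> (h y <= K)%N.
  have /finite_seqP [r rE] : finite_set (h @` S).
    apply: finite_image; apply: sub_finite_set (finite_image (+%R^~ a) (spanned_finite xp)).
    by move=> y Sy; exists (y - a) => //; rewrite subrK.
  exists (\max_(m <- r) m) => y Sy; apply: (@leq_bigmax_seq _ r predT id) => //.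
  have : (h @` S) (h y) by exists y.
  by rewrite rE.
pose D k := `[< exists2 y, S y & multiples A (p ^ k) y >].
have D0 : exists k, D k.
  exists 0%N; apply/asboolP; exists a; first by rewrite /S /= subrr; apply: subgroup0.
  by exists a; rewrite expn0 mulr1n.
have DK k : D k -> (k <= K)%N.
  move=> /asboolP [y Sy yk]; rewrite leqNgt; apply/negP => Kk.
  by apply: (hP y Sy); apply: multiples_exp_leq yk; apply: leq_trans (KP _ Sy) (ltnW Kk).
case: (ex_maxnP D0 DK) => m /asboolP [y Sy ym] m_max.
exists y; split=> // s k Ss ysk; apply: multiples_exp_leq ym; apply: m_max.
apply/asboolP; exists (y + s) => //.
by rewrite /S /= addrAC; apply: subgroupD.
Qed.

(** Zero is a filler for the indices that contribute no basis element, so that every basis, finite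
    or not, is indexed by [nat]. A genuine term is independent of the previous ones and of maximal
    height in its coset. *)
Definition valuated_step (x : nat -> A) (n : nat) :=
  (x n = 0 \/ forall s, spanned x n s -> x n + s <> 0 /\
    forall k, multiples A (p ^ k) (x n + s) -> multiples A (p ^ k) (x n)).

Lemma spanned_ext x x' n : (forall i, (i < n)%N -> x i = x' i) ->
  spanned x n = spanned x' n.
Proof.
move=> xx'; apply/seteqP; split=> _ [c ->]; exists c; apply: eq_bigr => i _.
  by rewrite xx'.
by rewrite -xx'.
Qed.

Lemma valuated_step_ext x x' n : (forall i, (i <= n)%N -> x i = x' i) ->
  valuated_step x n -> valuated_step x' n.
Proof.
move=> xx'; rewrite /valuated_step xx' // (@spanned_ext x x') // => i /ltnW.
exact: xx'.
Qed.

Lemma spanned_killed x n a : (forall i, (i < n)%N -> x i *+ p = 0) ->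
  spanned x n a -> a *+ p = 0.
Proof.
by move=> xp [c ->]; rewrite -sumrMnl big1 // => i _; rewrite mulrnAC xp ?mul0rn.
Qed.

Lemma spannedS x n a m : spanned x n a -> spanned x n.+1 (a + x n *+ m).
Proof.
move=> [c ->]; exists (fun i => if i == n then m else c i).
rewrite big_ord_recr /= eqxx; congr (_ + _); apply: eq_bigr => i _.
by rewrite ltn_eqF.
Qed.

(** Stage n treats [e n]: if it lies in the socle and not in the span so far, a representative of
    maximal height of its coset is adjoined; otherwise the filler 0 is. *)
Lemma valuated_sequence (e : nat -> A) : exists x : nat -> A,
  [/\ forall n, x n *+ p = 0,
      forall n, valuated_step x n
    & forall n, e n *+ p = 0 -> spanned x n.+1 (e n)].
Proof.
(* [F l] is the term that follows the finite list [l]; the local [x] is [l] continued by that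
   term. *)
have /choice[F FP] : forall l : seq A, exists y : A,
    let x i := if (i < size l)%N then l`_i else y in
    (forall i, (i < size l)%N -> l`_i *+ p = 0) ->
    [/\ y *+ p = 0, valuated_step x (size l)
      & e (size l) *+ p = 0 -> spanned x (size l).+1 (e (size l))].
  move=> l; set n := size l; set a := e n.
  have [[ap Sa]|trivial_a] :=
      pselect (a *+ p = 0 /\ ~ spanned (nth 0 l) n a); last first.
    exists 0 => /= lp; split; first by rewrite mul0rn.
      by left; rewrite ltnn.
    move=> ap; set x := (x in spanned x); have xE : x n = 0 by rewrite /x ltnn.
    have Sa : spanned (nth 0 l) n a.
      by apply: contrapT => Sa; apply: trivial_a.
    rewrite -[a]addr0 -[0](mul0rn _ 0) -xE; apply: spannedS.
    by rewrite (@spanned_ext _ (nth 0 l)) // => i; rewrite /x => ->.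
  have [lp|] := pselect (forall i, (i < n)%N -> l`_i *+ p = 0); last by exists 0.
  have [y [Sya y_max]] := maximal_height a lp.
  exists y => x _.
  have xE : x n = y by rewrite /x ltnn.
  have SE : spanned x n = spanned (nth 0 l) n.
    by apply: spanned_ext => i; rewrite /x => ->.
  have sS := spanned_subgroup lp.
  split.
  - by rewrite -[y](subrK a) mulrnDl ap addr0; apply: spanned_killed Sya.
  - right=> s; rewrite xE SE => Ss; split; last by move=> k; apply: y_max.
    move/eqP; rewrite addr_eq0 => /eqP yE; apply: Sa.
    have -> : a = - s - (y - a) by rewrite -yE opprB addrC subrK.
    by apply: subgroupB => //; apply: subgroupN.
  - move=> _; have -> : a = - (y - a) + x n *+ 1 by rewrite xE mulr1n opprB subrK.
    by apply: spannedS; rewrite SE; apply: subgroupN.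
pose L := fix L n := if n is m.+1 then rcons (L m) (F (L m)) else [::].
pose x n := F (L n); exists x.
have LE n : L n = mkseq x n by elim: n => //= n IHn; rewrite mkseqS -IHn.
have sL n : size (L n) = n by rewrite LE size_mkseq.
have Lx n i : (i < n)%N -> (L n)`_i = x i by move=> i_n; rewrite LE nth_mkseq.
have xE n i : (i <= n)%N -> (if (i < size (L n))%N then (L n)`_i else F (L n)) = x i.
  by rewrite sL leq_eqVlt => /predU1P[->|i_n]; rewrite ?ltnn // i_n Lx.
have main n : [/\ x n *+ p = 0, valuated_step x n & e n *+ p = 0 -> spanned x n.+1 (e n)].
  elim/ltn_ind: n => n IHn.
  have [|xp xv xe] := FP (L n).
    by rewrite sL => i i_n; rewrite Lx //; case: (IHn _ i_n).
  split=> //.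
    by move: xv; rewrite sL; apply: valuated_step_ext => i i_n; rewrite -(xE n i i_n) sL.
  by move: xe; rewrite sL (@spanned_ext _ x) // => i i_n; rewrite -(xE n i i_n) sL.
by split=> n; case: (main n).
Qed.

Section ValuatedSequence.
Variable x : nat -> A.
Hypotheses (xp : forall n, x n *+ p = 0) (xv : forall n, valuated_step x n).

(** The hypotheses force [m] to be prime to p, and [d] is an inverse of [m] modulo p. *)
Lemma mulrn_prime_inv (a : A) m : a *+ p = 0 -> a *+ m <> 0 ->
  exists d, forall b : A, b *+ p = 0 -> b *+ m *+ d = b.
Proof.
move=> ap am; have m_p : coprime m p.
  rewrite coprime_sym prime_coprime //; apply/negP => /dvdnP[q mE].
  by apply: am; rewrite mE mulnC mulrnA ap mul0rn.
have m0 : (0 < m)%N by case: m am {m_p} => // /(_ (mulr0n _)).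
have [u v uv _] := egcdnP p m0; exists u => b bp.
rewrite -mulrnA mulnC uv (eqP m_p) mulrnDr mulnC mulrnA bp mul0rn add0r.
by rewrite mulr1n.
Qed.

Lemma valuated_independent n (c : nat -> nat) : \sum_(i < n) x i *+ c i = 0 ->
  forall i, (i < n)%N -> x i *+ c i = 0.
Proof.
elim: n => // n IHn; rewrite big_ord_recr /= => sum0.
suff xc0 : x n *+ c n = 0.
  move: sum0; rewrite xc0 addr0 => /IHn xc i.
  by rewrite ltnS leq_eqVlt => /predU1P[->//|]; apply: xc.
apply: contrapT => xc; have [d dE] := mulrn_prime_inv (xp n) xc.
have [x0|xs] := xv n; first by rewrite x0 mul0rn in xc.
have Ss : spanned x n ((\sum_(i < n) x i *+ c i) *+ d).
  by exists (fun i => c i * d)%N; rewrite -sumrMnl; apply: eq_bigr => i _; rewrite mulrnA.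
have [] := xs _ Ss; case.
by rewrite -{1}(dE _ (xp n)) -mulrnDl addrC sum0 mul0rn.
Qed.

(** This is compatibility with heights. Once its coefficient is normalised to 1, the last term has
    maximal height in its coset, so it is at least as divisible as the sum; subtract it and
    induct. *)
Lemma valuated_multiples n (c : nat -> nat) k : multiples A (p ^ k) (\sum_(i < n) x i *+ c i) ->
  forall i, (i < n)%N -> multiples A (p ^ k) (x i *+ c i).
Proof.
have sM := multiples_subgroup A (p ^ k).
elim: n => // n IHn; rewrite big_ord_recr /= => sumM.
suff xcM : multiples A (p ^ k) (x n *+ c n).
  have := subgroupB sM sumM xcM; rewrite addrK => /IHn xc i.
  by rewrite ltnS leq_eqVlt => /predU1P[->//|]; apply: xc.
have [->|xc] := pselect (x n *+ c n = 0); first exact: subgroup0.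
have [d dE] := mulrn_prime_inv (xp n) xc.
have [x0|xs] := xv n; first by rewrite x0 mul0rn in xc.
have Ss : spanned x n ((\sum_(i < n) x i *+ c i) *+ d).
  by exists (fun i => c i * d)%N; rewrite -sumrMnl; apply: eq_bigr => i _; rewrite mulrnA.
have [_ /(_ k) xk] := xs _ Ss; apply: subgroupMn => //; apply: xk.
by rewrite -{1}(dE _ (xp n)) -mulrnDl addrC; apply: subgroupMn.
Qed.

End ValuatedSequence.
End SocleBasis.

(** * Characters *)

(** A kernel that is a neighbourhood of 0 expresses continuity for the discrete topology on Q/Z. *)
Definition character (G : topologicalZmodType) : set (G -> rat_mod_int) :=
  [set f | zmod_morphism f /\ nbhs (0 : G) [set x | f x = 0]].
Arguments character : clear implicits.

Section Dual.
Variable G : topologicalZmodType.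

Definition dual : Type := set_type (character G).

Let character_zmod_closed : zmod_closed [in character G].
Proof.
apply: subgroupP => [|f g [fB f0] [gB g0]].
  by split=> [x y|]; [rewrite subrr | apply: filterS filterT].
split=> [x y|].
  rewrite -[LHS]/(f (x - y) - g (x - y)) -[RHS]/(f x - g x - (f y - g y)).
  by rewrite fB gB !opprD !opprK addrACA.
apply: filterS (filterI f0 g0) => x [/= fx gx].
by rewrite -[LHS]/(f x - g x) fx gx subrr.
Qed.

HB.instance Definition _ := SubChoice.on dual.
HB.instance Definition _ :=
  GRing.SubChoice_isSubZmodule.Build _ _ dual character_zmod_closed.

Definition eval (a : dual) : G -> rat_mod_int := val a.

Lemma evalP (a : dual) : character G (eval a).
Proof. exact/set_mem/valP. Qed.

HB.instance Definition _ (a : dual) :=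
  GRing.isZmodMorphism.Build G rat_mod_int (eval a) (evalP a).1.

Lemma eval_sub (a b : dual) g : eval (a - b) g = eval a g - eval b g.
Proof. by []. Qed.

Lemma eval0 g : eval 0 g = 0.
Proof. by []. Qed.

Lemma eval_add (a b : dual) g : eval (a + b) g = eval a g + eval b g.
Proof. by []. Qed.

Lemma eval_natmul (a : dual) n g : eval (a *+ n) g = eval a g *+ n.
Proof. by elim: n => // n IHn; rewrite !mulrS eval_add IHn. Qed.

Lemma eval_sum (I : Type) (r : seq I) (P : pred I) (F : I -> dual) g :
  eval (\sum_(i <- r | P i) F i) g = \sum_(i <- r | P i) eval (F i) g.
Proof. by apply: (big_morph (eval^~ g)) => // a b; apply: eval_add. Qed.

Lemma dual_ext (a b : dual) : eval a =1 eval b -> a = b.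
Proof. by move=> ab; apply/val_inj/funext. Qed.

Lemma evalB a x y : eval a (x - y) = eval a x - eval a y.
Proof. exact: raddfB. Qed.

Lemma evalD a x y : eval a (x + y) = eval a x + eval a y.
Proof. exact: raddfD. Qed.

Lemma eval_at0 a : eval a 0 = 0.
Proof. exact: raddf0. Qed.

Lemma evalMn a n x : eval a (x *+ n) = eval a x *+ n.
Proof. exact: raddfMn. Qed.

Lemma evalMz a n x : eval a (x *~ n) = eval a x *~ n.
Proof. exact: raddfMz. Qed.

Lemma eval_sumr a (I : Type) (r : seq I) (P : pred I) (F : I -> G) :
  eval a (\sum_(i <- r | P i) F i) = \sum_(i <- r | P i) eval a (F i).
Proof. exact: raddf_sum. Qed.

Lemma dual_of (f : G -> rat_mod_int) : zmod_morphism f ->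
  nbhs (0 : G) [set x | f x = 0] -> exists a : dual, eval a = f.
Proof.
move=> fB f0; have fc : character G f by [].
by exists (SigSub (mem_set fc)).
Qed.

Lemma eval_continuous (a : dual) (x : G) : nbhs x [set y | eval a y = eval a x].
Proof.
apply: filterS (nbhs_translate x (evalP a).2) => y /= /eqP.
by rewrite evalB subr_eq0 => /eqP.
Qed.

Lemma eval_closed (a : dual) q : closed [set g | eval a g = q].
Proof.
by move=> x clx; have [y [/= <- /= ->]] := clx _ (eval_continuous a x).
Qed.

End Dual.

(** * Duality between a pro-p group and its characters *)

Section Duality.
Variables (p : nat) (G : topologicalZmodType).
Hypotheses (p_pr : prime p) (hG : prop_group p G).

Let p_gt0 : (0 < p)%N. Proof. exact: prime_gt0. Qed.

Let cG : compact [set: G]. Proof. by case: hG. Qed.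
Let hausG : hausdorff_space G. Proof. by case: hG. Qed.
Let bG : forall V : set G, nbhs 0 V ->
  exists U, [/\ subgroup U, nbhs 0 U, U `<=` V & exists k, forall x, U (x *+ p ^ k)].
Proof. by case: hG. Qed.

(** Vanishing on [U] is used twice: some p^k G lies in [U], so every element has a positive multiple
    in the domain of [R], and the extension has a kernel containing [U], so it is continuous. *)
Lemma dual_extension (R : set (G * rat_mod_int)) (U : set G) :
  subgroup R -> (forall y, R (0, y) -> y = 0) -> nbhs 0 U ->
  (forall u, U u -> R (u, 0)) -> exists a : dual G, forall x y, R (x, y) -> eval a x = y.
Proof.
move=> sR R_fun U0 RU; have [V [sV V0 VU [k Vk]]] := bG U0.
have [|f [fB fR]] := hom_extension (fun n y => @rat_mod_int_div n y) sR R_fun.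
  by move=> g; exists (p ^ k)%N, 0; split; [rewrite expn_gt0 p_gt0 | apply/RU/VU].
have [|a aE] := dual_of fB; last by exists a => x y /fR; rewrite aE.
by apply: filterS U0 => u /RU /fR.
Qed.

(** Take an open subgroup [U] missing [g] and the last p-power multiple h of [g] outside [U]. Then h
    has order p modulo [U], and sending h to 1/p and [U] to 0 extends to a character. *)
Lemma dual_separates (g : G) : g <> 0 -> exists a : dual G, eval a g <> 0.
Proof.
move=> g0.
have [U [sU U0 Ug [k Uk]]] : exists U, [/\ subgroup U, nbhs 0 U, ~ U g
    & exists k, forall x, U (x *+ p ^ k)].
  have : ~ cluster (nbhs 0) g by move=> /hausG/esym.
  move=> ncl; have [V [W [V0 [Wg VW]]]] : exists V W, nbhs 0 V /\ nbhs g W /\ V `&` W = set0.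
    apply: contrapT => noVW; apply: ncl => V W V0 Wg; apply/set0P/eqP => VW.
    by apply: noVW; exists V, W.
  have [U [sU U0 UV Uk]] := bG V0; exists U; split=> // /UV Vg.
  have : (V `&` W) g by split=> //; apply: nbhs_singleton.
  by rewrite VW.
have [j [Uj Uj']] : exists j, ~ U (g *+ p ^ j) /\ U (g *+ p ^ j *+ p).
  have := Uk g; elim: k {Uk} => [|k IHk] Uk; first by rewrite expn0 mulr1n in Uk.
  have [/IHk//|Ugk] := pselect (U (g *+ p ^ k)).
  by exists k; split=> //; rewrite -mulrnA -expnSr.
set h := g *+ p ^ j.
pose R := [set xy : G * rat_mod_int |
  exists (n : int), U (xy.1 - h *~ n) /\ xy.2 = unit_fraction p 1 *~ n].
have [||||a aR] := @dual_extension R U.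
- apply: subgroupP => [|[x y] [x' y'] [n [/= Ux ->]] [n' [/= Ux' ->]]].
    by exists 0; rewrite /= !mulr0z subr0; split=> //; apply: subgroup0.
  exists (n - n'); split; last by rewrite mulrzBr.
  have -> : x - x' - h *~ (n - n') = x - h *~ n - (x' - h *~ n').
    by rewrite mulrzBr !opprD !opprK addrACA.
  exact: subgroupB.
- move=> y [n [/= Un ->]].
  have {}Un : U (h *~ n) by have := subgroupN sU Un; rewrite opprB subr0; apply.
  have Up : U (h *~ p) by rewrite -pmulrn.
  (* If p did not divide [n], Bezout's identity would put [h] itself in [U]. *)
  have [/dvdzP[q ->]|ndvd] := boolP (p %| n)%Z.
    rewrite mulrC mulrzA -pmulrn; suff -> : unit_fraction p 1 *+ p = 0 by rewrite mul0rz.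
    by apply/eqP; rewrite unit_fractionMn_eq0 // expn1.
  have : coprimez p n by rewrite coprimezE /= prime_coprime.
  move=> /coprimezP[[u v] /= uv]; case: Uj.
  rewrite -/h -[h]mulr1z -uv mulrzDr [u * _]mulrC [v * _]mulrC !mulrzA.
  by apply: subgroupD => //; apply: subgroupMz.
- by [].
- by move=> u Uu; exists 0; rewrite /= !mulr0z subr0.
exists a => ag0.
have /aR : R (h, unit_fraction p 1).
  by exists 1; rewrite /= !mulr1z subrr; split=> //; apply: subgroup0.
rewrite evalMn ag0 mul0rn => /esym/eqP.
by rewrite -[X in X == _]mulr1n unit_fractionMn_eq0 // dvdn1 expn1; case: p p_pr => [|[]].
Qed.

Lemma dual_p_torsion (a : dual G) : exists k, a *+ p ^ k = 0.
Proof.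
have [U [_ _ Ua [k Uk]]] := bG (evalP a).2; exists k; apply: dual_ext => g.
by rewrite eval_natmul -evalMn; apply: Ua.
Qed.

Lemma natmul_image_closed n : closed (multiples G n).
Proof.
apply: compact_closed hausG _.
have -> : multiples G n = (fun x => x *+ n) @` setT.
  by apply/seteqP; split=> [_ [b <-]|_ [b _ <-]]; exists b.
apply: continuous_compact cG; apply: continuous_subspaceT.
exact: topgroup_natmul_continuous.
Qed.

(* Division of [a] by [n] is imposed on [n G] and extended by injectivity of
   Q/Z; compactness provides an open subgroup [U] on which the extension can be
   prescribed to vanish, which makes it continuous. *)
Lemma dual_divisible (a : dual G) n : (forall g, g *+ n = 0 -> eval a g = 0) ->
  multiples (dual G) n a.
Proof.
move=> an; pose C := [set g | eval a g != 0].
have clC : closed C.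
  move=> x clx; have [y [/= Cy yx]] := clx _ (eval_continuous a x).
  by rewrite /C /= -yx.
have clnC : closed ((fun x => x *+ n) @` C).
  apply: compact_closed hausG _; apply: continuous_compact.
    by apply: continuous_subspaceT; apply: topgroup_natmul_continuous.
  exact: subclosed_compact cG _.
have nC0 : nbhs 0 (~` ((fun x => x *+ n) @` C)).
  apply: open_nbhs_nbhs; split; first exact: closed_openC.
  by move=> [g /= /eqP Cg /an].
have [U [sU U0 UC _]] := bG nC0.
have ker g : U (g *+ n) -> eval a g = 0.
  by move=> /UC nCg; apply/eqP/negPn/negP => ag; apply: nCg; exists g.
pose R := [set xy : G * rat_mod_int | exists2 g, U (xy.1 - g *+ n) & xy.2 = eval a g].
have [||||b bR] := @dual_extension R U.
- apply: subgroupP => [|[x y] [x' y'] [g /= Ux ->] [g' /= Ux' ->]].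
    by exists 0; rewrite /= ?eval_at0 // mul0rn subr0; apply: subgroup0.
  exists (g - g'); last by rewrite /= evalB.
  rewrite /= mulrnBl.
  have -> : x - x' - (g *+ n - g' *+ n) = x - g *+ n - (x' - g' *+ n).
    by rewrite !opprD !opprK addrACA.
  exact: subgroupB.
- move=> y [g /= Ug ->]; apply: ker; have := subgroupN sU Ug.
  by rewrite opprB subr0; apply.
- by [].
- by move=> u Uu; exists 0; rewrite /= ?eval_at0 // mul0rn subr0.
exists b; apply: dual_ext => g; rewrite eval_natmul -evalMn; apply: bR.
by exists g; rewrite //= subrr; apply: subgroup0.
Qed.

Lemma eval_multiples (a : dual G) n g :
  multiples (dual G) n a -> g *+ n = 0 -> eval a g = 0.
Proof. by move=> [b <-] gn; rewrite eval_natmul -evalMn gn eval_at0. Qed.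

Lemma eval_multiples_eq0 n g :
  (forall a, multiples (dual G) n a -> eval a g = 0) -> g *+ n = 0.
Proof.
move=> ng; apply: contrapT => /dual_separates [a]; apply.
by rewrite evalMn -eval_natmul; apply: ng; exists a.
Qed.

(** With p^k the p-part of an exponent n of [g], the value of any character at p^k g is killed both
    by the prime-to-p part of n and by a power of p. *)
Lemma torsion_p_torsion g : torsion G g -> exists k, g *+ p ^ k = 0.
Proof.
move=> [n n0 gn]; exists (logn p n).
set k := logn p n.
apply: contrapT => /dual_separates [a]; apply.
have [m am] := dual_p_torsion a.
have [m' pm' nE] := pfactor_coprime p_pr n0.
have: eval a (g *+ p ^ k) *+ m' = 0 by rewrite -evalMn -mulrnA mulnC -nE gn eval_at0.
have: eval a (g *+ p ^ k) *+ p ^ m = 0 by rewrite -eval_natmul am.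
set q := eval a _ => qp qn.
have cop : coprime m' (p ^ m) by rewrite coprime_sym coprimeXl.
have m'0 : (0 < m')%N by move: n0; rewrite nE muln_gt0 => /andP[].
have [u v uv _] := egcdnP (p ^ m) m'0.
have : q *+ (u * m') = 0 by rewrite mulnC mulrnA qn mul0rn.
by rewrite uv (eqP cop) mulrnDr mulnC mulrnA qp mul0rn add0r mulr1n.
Qed.

(** Otherwise the complements of finite unions of cosets would have a common point, which lies in
    its own coset. *)
Lemma finite_transversal (U : set G) : subgroup U -> nbhs 0 U ->
  exists r : seq G, forall g, exists2 x, x \in r & U (g - x).
Proof.
move=> sU U0; apply: contrapT => no_r.
pose W (r : seq G) := [set g | forall x, x \in r -> ~ U (g - x)].
have [||||g [_ Wg]] := @compact_filter_base G setT (range W) cG.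
- by exists (W [::]), [::].
- move=> _ _ [r _ <-] [r' _ <-]; exists (W (r ++ r')); first by exists (r ++ r').
  by move=> g Wg; split=> x xr; apply: Wg; rewrite mem_cat xr ?orbT.
- move=> _ [r _ <-] g clg x xr Ugx.
  have [y [Wy /= Uyg]] := clg _ (nbhs_translate g U0); apply: (Wy x xr).
  by rewrite -[y](subrK g) -addrA; apply: subgroupD.
- move=> _ [r _ <-]; apply: contrapT => noW; apply: no_r; exists r => g.
  apply: contrapT => gr; apply: noW; exists g; split=> // x xr Ugx.
  by apply: gr; exists x.
have := Wg _ (imageT W [:: g]) g (mem_head _ _).
by rewrite subrr; apply; apply: subgroup0.
Qed.

Lemma countable_filtration : exists (U : nat -> set G) (r : nat -> seq G),
  [/\ forall n, subgroup (U n), forall n, nbhs 0 (U n),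
      forall V : set G, nbhs 0 V -> exists n, U n `<=` V
    & forall n g, exists2 x, x \in r n & U n (g - x)].
Proof.
have [_ _ _ [B [cB B0 BV]]] := hG.
have Bn0 : B !=set0 by have [b Bb _] := BV setT filterT; exists b.
have [b bB] : exists b : nat -> set G, B = range b.
  have /pfcard_geP[BE|[f]] := cB; first by case: Bn0 => b; rewrite BE.
  exists f; apply/seteqP; split=> [x /'surj_f [n _ <-]|_ [n _ <-]]; last exact: funS.
  by exists n.
have /choice[U UP] : forall n, exists U, [/\ subgroup U, nbhs 0 U & U `<=` b n].
  by move=> n; have [|U [sU U0 Ub _]] := @bG (b n); [apply: B0; rewrite bB; exists n | exists U].
have /choice[r rP] : forall n, exists r : seq G, forall g, exists2 x, x \in r & U n (g - x).
  by move=> n; have [sU U0 _] := UP n; apply: finite_transversal.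
exists U, r; split=> // [n|n|V /BV[b' + bV]]; [by case: (UP n) | by case: (UP n) |].
rewrite bB => -[n _ bE]; move: bV; rewrite -bE => bV; exists n; have [_ _ Ub] := UP n.
exact: subset_trans Ub bV.
Qed.

(** A character vanishing on some [U n] is determined by n and its values on the finite transversal
    [r n]; countability of Q/Z turns these data into a natural number. *)
Lemma dual_enumeration : exists e : nat -> dual G, forall a, exists n, e n = a.
Proof.
have [U [r [sU U0 UV rP]]] := countable_filtration.
have [q q_inj] := rat_mod_int_countable.
have /choice[m mP] : forall a : dual G, exists n, U n `<=` [set g | eval a g = 0].
  by move=> a; apply: UV; case: (evalP a).
pose code (a : dual G) := pickle (m a, [seq q (eval a x) | x <- r (m a)]).
have code_inj : injective code.
  move=> a b /(pcan_inj pickleK) [mE]; rewrite -mE.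
  set n := m a => /eq_in_map abE; apply: dual_ext => g.
  have [x xr Ugx] := rP n g.
  have /q_inj abx := abE x xr.
  have ker c : m c = n -> eval c g = eval c x.
    move=> mc; have := mP c (g - x); rewrite mc => /(_ Ugx) /= /eqP.
    by rewrite evalB subr_eq0 => /eqP.
  by rewrite !ker.
pose e n := xget 0 [set a | code a = n]; exists e => a; exists (code a).
by apply: code_inj; apply: (@xgetI _ 0 [set b | code b = code a] a).
Qed.

End Duality.

Lemma compact_nested (T : topologicalType) (F : nat -> set T) :
  compact [set: T] -> (forall n, closed (F n)) ->
  (forall n, exists y, forall i, (i < n)%N -> F i y) ->
  exists y, forall n, F n y.
Proof.
move=> cT clF Fn; pose W n := [set y | forall i, (i < n)%N -> F i y].
have [||||y [_ Wy]] := @compact_filter_base T setT (range W) cT.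
- by exists (W 0%N), 0%N.
- move=> _ _ [m _ <-] [n _ <-]; exists (W (maxn m n)); first by exists (maxn m n).
  by move=> y Wy; split=> i i_lt; apply: Wy; rewrite leq_max i_lt ?orbT.
- move=> _ [n _ <-] y cly i i_n; apply: clF => V /cly[z [Wz Vz]].
  by exists z; split=> //; apply: Wz.
- by move=> _ [n _ <-]; have [y Wy] := Fn n; exists y.
by exists y => n; apply: (Wy (W n.+1)) => //; exists n.+1.
Qed.

Lemma unit_fraction_gen1 p (v w : rat_mod_int) : prime p ->
  w *+ p = 0 -> w <> 0 -> v *+ p = 0 -> exists m, v = w *+ m.
Proof.
move=> p_pr; have p_gt0 := prime_gt0 p_pr; rewrite -{1 2}[p]expn1.
move=> /(unit_fraction_gen p_gt0) [a ->] w0 /(unit_fraction_gen p_gt0) [b ->].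
have gp : unit_fraction p 1 *+ p = 0.
  by apply/eqP; rewrite unit_fractionMn_eq0 // expn1.
have [d dE] := mulrn_prime_inv p_pr gp w0.
by exists (d * b)%N; rewrite mulrnA dE.
Qed.

(** * Prescribing the values of independent characters *)

Section Interpolation.
Variables (p : nat) (G : topologicalZmodType) (x : nat -> dual G).
Hypotheses (p_pr : prime p) (xp : forall n, x n *+ p = 0).
Hypothesis x_ind : forall n (c : nat -> nat), \sum_(i < n) x i *+ c i = 0 ->
  forall i, (i < n)%N -> x i *+ c i = 0.

Let p_gt0 : (0 < p)%N. Proof. exact: prime_gt0. Qed.
Let gamma := unit_fraction p 1.
Let gamma_p : gamma *+ p = 0.
Proof. by apply/eqP; rewrite unit_fractionMn_eq0 // expn1. Qed.
Let gamma_gen v : v *+ p = 0 -> exists m, v = gamma *+ m.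
Proof. by rewrite -{1}[p]expn1 => /(unit_fraction_gen p_gt0). Qed.

(** By induction it suffices to find [h] killed by the earlier characters but not by [x N]. If there
    were none, [x N] would be a combination of the earlier ones, against independence. *)
Lemma socle_interpolation N (u : nat -> rat_mod_int) :
  (forall n, u n *+ p = 0) -> (forall n, x n = 0 -> u n = 0) ->
  exists g, forall n, (n < N)%N -> eval (x n) g = u n.
Proof.
elim: N u => [|N IHN] u up u0; first by exists 0.
have [g0 g0E] := IHN u up u0.
have [xN0|xN0] := pselect (x N = 0).
  exists g0 => n; rewrite ltnS leq_eqVlt => /predU1P[->|]; last exact: g0E.
  by rewrite u0 // xN0.
suff [h [hker hN]] : exists h, (forall n, (n < N)%N -> eval (x n) h = 0)
    /\ eval (x N) h <> 0.
  have [||m mE] := unit_fraction_gen1 (v := u N - eval (x N) g0) p_pr _ hN.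
  - by rewrite -eval_natmul xp.
  - by rewrite mulrnBl up -eval_natmul xp subrr.
  exists (g0 + h *+ m) => n; rewrite evalD evalMn ltnS leq_eqVlt.
  move=> /predU1P[->|nN]; first by rewrite -mE addrC subrK.
  by rewrite hker // mul0rn addr0 g0E.
apply: contrapT => no_h; apply: xN0.
(* A system dual to the earlier characters; the coefficients of [x N] are read off on it. At fillers
   the prescribed value has to be 0. *)
have /choice[e eE] : forall i : nat, exists g, forall n, (n < N)%N ->
    eval (x n) g = if (n == i) && (x n != 0) then gamma else 0.
  move=> i; apply: IHN => n; first by case: ifP => _; rewrite ?mul0rn.
  by move=> ->; rewrite eqxx andbF.
have /choice[c cE] : forall i, exists c, eval (x N) (e i) = gamma *+ c.
  by move=> i; apply: gamma_gen; rewrite -eval_natmul xp.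
have xNE : x N = \sum_(i < N) x i *+ c i.
  apply: dual_ext => g.
  have /choice[m mE] : forall i, exists m, eval (x i) g = gamma *+ m.
    by move=> i; apply: gamma_gen; rewrite -eval_natmul xp.
  pose h := g - \sum_(i < N) e i *+ m i.
  have hN : eval (x N) h = 0.
    apply: contrapT => hN; apply: no_h; exists h; split=> // n nN.
    rewrite evalB eval_sumr (bigD1 (Ordinal nN)) //= big1 ?addr0 => [|i ni].
      rewrite evalMn eE // eqxx /=; case: eqP => [x0|_]; last by rewrite mE subrr.
      by rewrite mul0rn subr0 x0.
    rewrite evalMn eE // ifN ?mul0rn // negb_and.
    by move: ni; rewrite -val_eqE /= eq_sym => ->.
  have -> : eval (x N) g = eval (x N) (\sum_(i < N) e i *+ m i).
    by apply/eqP; rewrite -subr_eq0 -evalB hN.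
  rewrite eval_sumr eval_sum; apply: eq_bigr => i _.
  by rewrite evalMn cE eval_natmul mE -!mulrnA mulnC.
(* The last coefficient stands for -1 and turns the expression of [x N] into a relation. *)
pose c' i := if (i < N)%N then c i else p.-1.
have : \sum_(i < N.+1) x i *+ c' i = 0.
  rewrite big_ord_recr /= {2}/c' ltnn.
  have -> : \sum_(i < N) x i *+ c' i = x N.
    by rewrite xNE; apply: eq_bigr => i _; rewrite /c' ltn_ord.
  by rewrite -mulrS prednK.
move=> /x_ind /(_ N (ltnSn N)); rewrite /c' ltnn => xNp.
by have := xp N; rewrite -(prednK p_gt0) mulrS xNp addr0.
Qed.

Variables (z : nat -> dual G) (l : nat -> nat).
Hypotheses (zx : forall n, z n *+ p ^ l n = x n) (z0 : forall n, x n = 0 -> z n = 0).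

(* As in Nakayama's lemma: the image of G is everything modulo p, by
   [socle_interpolation], hence modulo every power of p. *)
Lemma finite_interpolation N (w : nat -> rat_mod_int) :
  (forall n, w n *+ p ^ (l n).+1 = 0) -> (forall n, x n = 0 -> w n = 0) ->
  exists g, forall n, (n < N)%N -> eval (z n) g = w n.
Proof.
move=> wp w0.
(* The error after M rounds is p^M times [w'], where [w' n] still has order dividing p^(l n + 1); so
   it vanishes for large M. *)
have approx M : exists g w', forall n, (n < N)%N ->
    [/\ eval (z n) g + w' n *+ p ^ M = w n, w' n *+ p ^ (l n).+1 = 0
      & x n = 0 -> w' n = 0].
  elim: M => [|M [g [w1 w1P]]].
    by exists 0, w => n _; rewrite eval_at0 add0r mulr1n; split; auto.
  (* Only the top layer p^(l n) [w1 n] is matched, by means of [x n]. What remains is killed by p^(l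
     n), so its p-th part is killed by p^(l n + 1). *)
  pose u n := if (n < N)%N then w1 n *+ p ^ l n else 0.
  have [n|n|g1 g1E] := @socle_interpolation N u.
  - rewrite /u; case: ifP => [/w1P[_ + _]|_]; last by rewrite mul0rn.
    by rewrite expnSr mulrnA.
  - by move=> xn; rewrite /u; case: ifP => // /w1P[_ _ ->//]; rewrite mul0rn.
  have /choice[w2 w2P] : forall n, exists w2, (n < N)%N ->
      w2 *+ p = w1 n - eval (z n) g1 /\ (x n = 0 -> w2 = 0).
    move=> n; have [xn|xn] := pselect (x n = 0).
      by exists 0 => /w1P[_ _ w10]; rewrite z0 // w10 // mul0rn subrr.
    by have [w2 w2E] := rat_mod_int_div (w1 n - eval (z n) g1) p_gt0; exists w2.
  exists (g + g1 *+ p ^ M), w2 => n nN; have [w2E w20] := w2P n nN.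
  have [wE _ _] := w1P n nN; split=> //.
    rewrite evalD evalMn expnS mulrnA w2E mulrnBl -wE -addrA; congr (_ + _).
    by rewrite addrC subrK.
  by rewrite expnS mulrnA w2E mulrnBl -eval_natmul zx g1E // /u nN subrr.
pose B := \max_(n < N) (l n).+1.
have [g [w' gP]] := approx B; exists g => n nN; have [<- wp' _] := gP n nN.
have lB : ((l n).+1 <= B)%N by apply: (@leq_bigmax _ (fun i : 'I_N => (l i).+1) (Ordinal nN)).
by rewrite -(subnKC lB) expnD mulrnA wp' mul0rn addr0.
Qed.

End Interpolation.

(** * The decomposition *)

Section ProductTopology.
Variables (I : Type) (T : I -> topologicalType).

Lemma prod_topology_continuous (S : topologicalType) (f : S -> prod_topology T) :
  (forall i, continuous (fun x => f x i)) -> continuous f.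
Proof.
move=> cf x; apply/cvg_sup => i.
exact: (@continuous_comp_initial _ _ _ (fun f : prod_topology T => f i) f (cf i)).
Qed.

Lemma prod_topology_proj_continuous i :
  continuous (fun f : prod_topology T => f i).
Proof.
move=> f; have /cvg_sup/(_ i) fi : f --> f by apply: cvg_id.
have := @initial_continuous _ _ (fun f : prod_topology T => f i) f.
by move=> pi; apply: cvg_trans pi; apply: cvg_app.
Qed.

End ProductTopology.

Lemma cluster_continuous (S T : topologicalType) (f : S -> T) (x y : S) :
  continuous f -> cluster (nbhs x) y -> cluster (nbhs (f x)) (f y).
Proof.
move=> cf xy V W /cf Vx /cf Wy; have [z [Vz Wz]] := xy _ _ Vx Wy.
by exists (f z).
Qed.

Lemma prod_topology_hausdorff (I : Type) (T : I -> topologicalType) :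
  (forall i, hausdorff_space (T i)) -> hausdorff_space (prod_topology T).
Proof.
move=> hT f g fg; apply: functional_extensionality_dep => i; apply: hT.
exact: cluster_continuous (@prod_topology_proj_continuous _ _ i) fg.
Qed.

Lemma pair_hausdorff (S T : topologicalType) :
  hausdorff_space S -> hausdorff_space T -> hausdorff_space (S * T)%type.
Proof.
move=> hS hT [x y] [x' y'] xy; congr pair.
  by apply: hS; apply: (@cluster_continuous _ _ fst _ _ _ xy) => z; exact: cvg_fst.
by apply: hT; apply: (@cluster_continuous _ _ snd _ _ _ xy) => z; exact: cvg_snd.
Qed.

Lemma cyclic_group_hausdorff n : hausdorff_space (cyclic_group n).
Proof. exact: discrete_hausdorff. Qed.

Lemma padic_int_hausdorff p : hausdorff_space (padic_int p).
Proof.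
move=> x y xy; apply: val_inj; apply: prod_topology_hausdorff.
  by move=> n; apply: cyclic_group_hausdorff.
by apply: cluster_continuous xy; apply: initial_continuous.
Qed.

Lemma compact_bijection_iso (G : topologicalZmodType) (H : PreTopologicalZmodule.type)
    (f : G -> H) :
  compact [set: G] -> hausdorff_space H -> zmod_morphism f -> continuous f ->
  (forall x, f x = 0 -> x = 0) -> (forall y, exists x, f x = y) ->
  topgroup_iso G H.
Proof.
move=> cG hH fB cf f_inj f_surj.
pose fA := HB.pack_for {additive G -> H} f (GRing.isZmodMorphism.Build G H f fB).
have /choice[g fg] := f_surj.
have gf x : g (f x) = x.
  by apply/eqP; rewrite -subr_eq0; apply/eqP/f_inj; rewrite fB fg subrr.
exists fA, g; split=> // y V Vgy.
have clf : closed (f @` (~` V°)).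
  apply: compact_closed hH _; apply: continuous_compact.
    exact: continuous_subspaceT.
  apply: subclosed_compact cG _ => //.
  exact/open_closedC/open_interior.
have : nbhs y (~` (f @` (~` V°))).
  apply: open_nbhs_nbhs; split; first exact: closed_openC.
  by case=> x Vx xy; apply: Vx; rewrite -(gf x) xy.
rewrite nbhs_simpl /=; apply: filterS => z Vz.
by apply: contrapT => Vgz; apply: Vz; exists (g z) => // /interior_subset.
Qed.

(** * From values in Q/Z to residues modulo powers of p *)

Section Residue.
Variable p : nat.
Hypothesis p_pr : prime p.
Let p_gt0 : (0 < p)%N. Proof. exact: prime_gt0. Qed.

Lemma expn_prime_gt1 k : (1 < p ^ k.+1)%N.
Proof. by rewrite -{1}(expn0 p) ltn_exp2l // prime_gt1. Qed.

Lemma natr_Zp_exp_eq0 k m : (p ^ k.+1 %| m)%N -> m%:R = 0 :> 'Z_(p ^ k.+1).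
Proof.
move=> /dvdnP[q ->]; apply: val_inj.
by rewrite /= val_Zp_nat ?expn_prime_gt1 // modnMl.
Qed.

Lemma unit_fraction_inj k m n :
  unit_fraction p k.+1 *+ m = unit_fraction p k.+1 *+ n ->
  m%:R = n%:R :> 'Z_(p ^ k.+1).
Proof.
wlog nm : m n / (n <= m)%N => [hw|] mn.
  by have [/hw|/ltnW/hw] := leqP n m; [apply|move=> /(_ (esym mn))].
apply/eqP; rewrite -subr_eq0 -natrB //; apply/eqP/natr_Zp_exp_eq0.
by rewrite -unit_fractionMn_eq0 // mulrnBr // mn subrr.
Qed.

(* A junk value unless [q] is killed by [p ^ k.+1]. *)
Definition residue k (q : rat_mod_int) : 'Z_(p ^ k.+1) :=
  (xget 0%N [set m | q = unit_fraction p k.+1 *+ m])%:R.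

Lemma residue_unit_fraction k m : residue k (unit_fraction p k.+1 *+ m) = m%:R.
Proof.
apply: unit_fraction_inj.
by have <- := @xgetI _ 0%N [set n | unit_fraction p k.+1 *+ m = unit_fraction p k.+1 *+ n] m erefl.
Qed.

Lemma residueD k q r : q *+ p ^ k.+1 = 0 -> r *+ p ^ k.+1 = 0 ->
  residue k (q + r) = residue k q + residue k r.
Proof.
move=> /(unit_fraction_gen p_gt0)[a ->] /(unit_fraction_gen p_gt0)[b ->].
by rewrite -mulrnDr !residue_unit_fraction natrD.
Qed.

Lemma residueB k q r : q *+ p ^ k.+1 = 0 -> r *+ p ^ k.+1 = 0 ->
  residue k (q - r) = residue k q - residue k r.
Proof.
move=> qp rp; apply/eqP; rewrite eq_sym subr_eq -residueD //.
  by rewrite subrK.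
by rewrite mulrnBl qp rp subrr.
Qed.

Lemma residue_eq0 k q : q *+ p ^ k.+1 = 0 -> residue k q = 0 -> q = 0.
Proof.
move=> /(unit_fraction_gen p_gt0)[a ->]; rewrite residue_unit_fraction => a0.
apply/eqP; rewrite unit_fractionMn_eq0 //.
by move/(congr1 val): a0; rewrite /= val_Zp_nat ?expn_prime_gt1 // => /eqP.
Qed.

Lemma residue_surj k (a : 'Z_(p ^ k.+1)) :
  exists2 q, q *+ p ^ k.+1 = 0 & residue k q = a.
Proof.
exists (unit_fraction p k.+1 *+ a).
  have -> : unit_fraction p k.+1 *+ a *+ p ^ k.+1 = unit_fraction p k.+1 *+ p ^ k.+1 *+ a.
    by rewrite mulrnAC.
  have /eqP -> : unit_fraction p k.+1 *+ p ^ k.+1 == 0 by rewrite unit_fractionMn_eq0.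
  by rewrite mul0rn.
by rewrite residue_unit_fraction natr_Zp.
Qed.

(** Makes the residues along a chain of successive divisions by p a p-adic integer. *)
Lemma residue_coherent k q : q *+ p ^ k.+2 = 0 ->
  residue k (q *+ p) = (nat_of_ord (residue k.+1 q))%:R.
Proof.
move=> /(unit_fraction_gen p_gt0)[a ->].
rewrite mulrnAC unit_fractionS // !residue_unit_fraction.
rewrite /= val_Zp_nat ?expn_prime_gt1 //.
rewrite {1}(divn_eq a (p ^ k.+2)) natrD natr_Zp_exp_eq0 ?add0r //.
by rewrite dvdn_mull // dvdn_exp2l.
Qed.

End Residue.

Lemma countable_cardinal_of_set (J : set nat) :
  exists (a : countable_cardinal) (f : cardinal_type a -> nat),
    injective f /\ range f = J.
Proof.
have [/finite_setP[n Jn]|Jinf] := pselect (finite_set J).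
  have /card_set_bijP[f [f1 f2 f3]] := card_esym Jn.
  exists (Defs.Finite n), (fun i : 'I_n => f i); split=> [i j fij|].
    by apply/val_inj/f2 => //; apply/mem_set/ltn_ord.
  apply/seteqP; split=> [_ [i _ <-]|m /f3[i i_n <-]]; first exact/f1/ltn_ord.
  by exists (Ordinal i_n).
have /card_esym/card_set_bijP[f [f1 f2 f3]] := eq_card_nat (countableP J) Jinf.
exists Aleph0, f; split=> [i j fij|]; first by apply: f2 => //; apply: mem_setT.
by apply/seteqP; split=> [_ [i _ <-]|m /f3[i _ <-]]; [apply: f1 | exists i].
Qed.

Lemma eval_closed_forall (G : topologicalZmodType) (T : Type) (P : T -> Prop)
    (a : T -> dual G) (q : T -> rat_mod_int) :
  closed [set g | forall t, P t -> eval (a t) g = q t].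
Proof.
move=> g clg t Pt; apply: (@eval_closed _ (a t) (q t)).
by apply: closure_subset clg => h; apply.
Qed.

(** * Coordinates attached to a valuated basis *)

Section Decomposition.
Variables (p : nat) (G : topologicalZmodType).
Hypotheses (p_pr : prime p) (hG : prop_group p G).
Variable x : nat -> dual G.
Hypotheses (xp : forall n, x n *+ p = 0).
Hypothesis xv : forall n, valuated_step p x n.
Hypothesis x_socle : forall a : dual G, a *+ p = 0 -> exists n, spanned x n a.
Hypothesis inf_height_div : forall a : dual G,
  (forall k, multiples (dual G) (p ^ k) a) ->
  exists2 b : dual G, (forall k, multiples (dual G) (p ^ k) b) & b *+ p = a.

Let p_gt0 : (0 < p)%N. Proof. exact: prime_gt0. Qed.
Let cG : compact [set: G]. Proof. by case: hG. Qed.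

Definition height_eq n k := [/\ x n <> 0, multiples (dual G) (p ^ k) (x n)
  & ~ multiples (dual G) (p ^ k.+1) (x n)].

Definition infinite_height n :=
  x n <> 0 /\ forall k, multiples (dual G) (p ^ k) (x n).

Lemma height_cases n : [\/ x n = 0, exists k, height_eq n k | infinite_height n].
Proof.
have [->|xn] := pselect (x n = 0); first by constructor 1.
have [xinf|xfin] := pselect (forall k, multiples (dual G) (p ^ k) (x n)).
  by constructor 3.
constructor 2; apply: contrapT => noh; apply: xfin; elim=> [|k IHk].
  by exists (x n); rewrite mulr1n.
by apply: contrapT => xk; apply: noh; exists k.
Qed.

Lemma height_eq_uniq n k l : height_eq n k -> height_eq n l -> k = l.
Proof.
wlog kl : k l / (k <= l)%N => [hw|] nk nl.
  by have [/hw/(_ nk nl)|/ltnW/hw/(_ nl nk)] := leqP k l.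
apply/eqP; rewrite eqn_leq kl leqNgt; apply/negP => k_l.
by case: nk => _ _; apply; case: nl => _ xl _; apply: multiples_exp_leq xl.
Qed.

Lemma height_eq_finite n k : height_eq n k -> ~ infinite_height n.
Proof. by move=> [_ _ xk] [_ /(_ k.+1)]. Qed.

(** The quotients can be kept of infinite height, so division by p never stops. *)
Lemma division_chain (a : dual G) : (forall k, multiples (dual G) (p ^ k) a) ->
  exists z : nat -> dual G, z 0%N = a /\ forall j, z j.+1 *+ p = z j.
Proof.
move=> ainf; pose S := {b : dual G | forall k, multiples (dual G) (p ^ k) b}.
have /choice[f fP] : forall b : S, exists c : S, sval c *+ p = sval b.
  by move=> [b binf]; have [c cinf cb] := inf_height_div binf; exists (exist _ c cinf).
pose z j : S := iter j f (exist _ a ainf).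
by exists (fun j => sval (z j)); split=> // j; apply: fP.
Qed.

(** The characters [y n] will give the cyclic coordinates, and each chain [z n] a p-adic one. *)
Lemma division_sequences : exists (y : nat -> dual G) (z : nat -> nat -> dual G),
  (forall n k, height_eq n k -> y n *+ p ^ k = x n) /\
  (forall n, infinite_height n -> z n 0%N = x n /\ forall j, z n j.+1 *+ p = z n j).
Proof.
have /choice[y yP] : forall n, exists y, forall k, height_eq n k -> y *+ p ^ k = x n.
  move=> n; have [[k nk]|noh] := pselect (exists k, height_eq n k); last first.
    by exists 0 => k nk; case: noh; exists k.
  have [_ [y yx] _] := nk.
  by exists y => l nl; rewrite -(height_eq_uniq nk nl).
have /choice[z zP] : forall n, exists z : nat -> dual G, infinite_height n ->
    z 0%N = x n /\ forall j, z j.+1 *+ p = z j.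
  move=> n; have [[_ xinf]|ninf] := pselect (infinite_height n).
    by have [z zP] := division_chain xinf; exists z.
  by exists (fun=> 0).
by exists y, z.
Qed.

Variables (y : nat -> dual G) (z : nat -> nat -> dual G).
Hypothesis yx : forall n k, height_eq n k -> y n *+ p ^ k = x n.
Hypothesis zx : forall n, infinite_height n -> z n 0%N = x n.
Hypothesis zz : forall n, infinite_height n -> forall j, z n j.+1 *+ p = z n j.

Lemma chain_mul n i j : infinite_height n -> z n (i + j) *+ p ^ i = z n j.
Proof.
move=> ninf; elim: i => [|i IHi]; first by rewrite mulr1n.
by rewrite expnS mulrnA addSn zz.
Qed.

(** By induction on the order of a character [a]. If p^(m+1) kills it, p^m [a] is a combination of
    basis elements of height at least m; subtracting from [a] the same combination of their p^m-th
    divisions, which all kill [g], leaves a character killed by p^m. *)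
Lemma coordinates_injective g :
  (forall n k, height_eq n k -> eval (y n) g = 0) ->
  (forall n, infinite_height n -> forall j, eval (z n j) g = 0) -> g = 0.
Proof.
move=> yg zg; apply: contrapT => /(dual_separates p_pr hG) [a]; apply.
have [m] := dual_p_torsion hG a; elim: m a => [|m IHm] a.
  by rewrite mulr1n => ->; rewrite eval0.
move=> am; have [|N [c aE]] := x_socle (a := a *+ p ^ m).
  by rewrite -mulrnA -expnSr.
have aM : multiples (dual G) (p ^ m) (\sum_(i < N) x i *+ c i) by exists a.
have /choice[d dP] : forall i : 'I_N, exists d : dual G,
    eval d g = 0 /\ d *+ p ^ m = x i *+ c i.
  move=> i; have xcM := valuated_multiples p_pr xp xv aM (ltn_ord i).
  have [->|xc] := pselect (x i *+ c i = 0).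
    by exists 0; rewrite eval0 mul0rn.
  have [e eE] := mulrn_prime_inv p_pr (xp i) xc.
  have xM : multiples (dual G) (p ^ m) (x i).
    by rewrite -(eE _ (xp i)); apply: subgroupMn => //; apply: multiples_subgroup.
  have [xi|[k ik]|iinf] := height_cases i; first by rewrite xi mul0rn in xc.
    have mk : (m <= k)%N.
      rewrite leqNgt; apply/negP => km; case: (ik) => _ _; apply.
      exact: multiples_exp_leq xM.
    exists (y i *+ p ^ (k - m) *+ c i); rewrite !eval_natmul (yg _ _ ik) !mul0rn.
    split=> //; rewrite mulrnAC; congr (_ *+ _).
    by rewrite -mulrnA -expnD subnK // yx.
  exists (z i m *+ c i); rewrite eval_natmul zg // mul0rn; split=> //.
  by rewrite mulrnAC -{1}[m]addn0 chain_mul // zx.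
have /IHm : (a - \sum_i d i) *+ p ^ m = 0.
  rewrite mulrnBl aE -sumrMnl; apply/eqP; rewrite subr_eq0; apply/eqP.
  by apply: eq_bigr => i _; have [_ ->] := dP i.
rewrite eval_sub eval_sum big1 ?subr0 // => i _.
by have [] := dP i.
Qed.

(** By compactness finitely many conditions suffice. Below a bound [L], the single character [z n L]
    controls the chain [z n], since the earlier members are its multiples. *)
Lemma coordinates_surjective (w : nat -> rat_mod_int) (v : nat -> nat -> rat_mod_int) :
  (forall n k, height_eq n k -> w n *+ p ^ k.+1 = 0) ->
  (forall n, infinite_height n -> v n 0%N *+ p = 0) ->
  (forall n, infinite_height n -> forall j, v n j.+1 *+ p = v n j) ->
  exists g, (forall n k, height_eq n k -> eval (y n) g = w n) /\
    forall n, infinite_height n -> forall j, eval (z n j) g = v n j.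
Proof.
move=> wp v0 vv.
have vmul n i j : infinite_height n -> v n (i + j)%N *+ p ^ i = v n j.
  move=> ninf; elim: i => [|i IHi]; first by rewrite mulr1n.
  by rewrite expnS mulrnA addSn vv.
(* The dummy index of type [unit] gives the condition the form required by [eval_closed_forall]. *)
pose F n := [set g | forall t : unit, (exists k, height_eq n k) -> eval (y n) g = w n] `&`
  [set g | forall t : nat * nat, [/\ (t.1 <= n)%N, (t.2 <= n)%N & infinite_height t.1] ->
     eval (z t.1 t.2) g = v t.1 t.2].
have clF n : closed (F n) by apply: closedI; apply: eval_closed_forall.
have [L|g gF] := compact_nested cG clF; last first.
  exists g; split=> [n k nk|n ninf j].
    by have [/(_ tt) yn _] := gF n; apply: yn; exists k.
  have [_ /(_ (n, j))] := gF (maxn n j); apply; split=> //=; first exact: leq_maxl.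
  exact: leq_maxr.
(* [t n] consists of an exponent, a character dividing [x n] by that power of p, and its prescribed
   value; fillers get zeros. *)
have /choice[t tP] : forall n, exists t : nat * (dual G * rat_mod_int),
  [/\ t.2.1 *+ p ^ t.1 = x n, x n = 0 -> t.2.1 = 0, t.2.2 *+ p ^ t.1.+1 = 0,
      x n = 0 -> t.2.2 = 0 &
      (forall k, height_eq n k -> t.2 = (y n, w n)) /\
      (infinite_height n -> t = (L, (z n L, v n L)))].
  move=> n; have [xn|[k nk]|ninf] := height_cases n.
  - exists (0%N, (0, 0)); rewrite /= !mul0rn; split=> //; split.
      by move=> k [].
    by case.
  - exists (k, (y n, w n)); rewrite /= (yx nk) (wp _ _ nk); split=> //; try by case: nk.
    by split=> // /(height_eq_finite nk).
  - exists (L, (z n L, v n L)); rewrite /=; split=> //; try by case: ninf.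
    + by have := chain_mul L 0 ninf; rewrite addn0 zx.
    + by rewrite expnSr mulrnA; have := vmul n L 0%N ninf; rewrite addn0 => ->; apply: v0.
    + by split=> // k nk; case: (height_eq_finite nk).
have [||||g gE] := @finite_interpolation p G x p_pr xp (valuated_independent p_pr xp xv)
    (fun n => (t n).2.1) (fun n => (t n).1) _ _ L (fun n => (t n).2.2).
- by move=> n; case: (tP n).
- by move=> n; case: (tP n).
- by move=> n; case: (tP n).
- by move=> n; case: (tP n).
exists g => i iL; split=> /=.
  move=> _ [k ik]; have := gE i iL; have [_ _ _ _ [/(_ _ ik) -> _]] := tP i.
  by [].
move=> [n j] /= [ni ji ninf].
have := gE n (leq_ltn_trans ni iL); have [_ _ _ _ [_ /(_ ninf) ->]] := tP n.
move=> /= zE; have jL : (j <= L)%N by apply: leq_trans ji (ltnW iL).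
by rewrite -(chain_mul (L - j) j ninf) -(vmul n (L - j)%N j ninf) eval_natmul subnK // zE.
Qed.

End Decomposition.

Lemma residue_eval_continuous (p : nat) (G : topologicalZmodType) (a : dual G) k :
  continuous (fun g => residue p k (eval a g) : cyclic_group (p ^ k.+1)).
Proof.
move=> g V /nbhs_singleton Vg; rewrite nbhs_simpl /=.
by apply: filterS (eval_continuous a g) => h /= ->.
Qed.

Lemma unit_fraction_natr (p : nat) k m : prime p ->
  unit_fraction p k.+1 *+ nat_of_ord (m%:R : 'Z_(p ^ k.+1)) = unit_fraction p k.+1 *+ m.
Proof.
move=> p_pr; have p_gt0 := prime_gt0 p_pr.
rewrite val_Zp_nat ?expn_prime_gt1 // [in RHS](divn_eq m (p ^ k.+1)) mulrnDr.
rewrite [X in X + _](_ : _ = 0) ?add0r //.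
by apply/eqP; rewrite unit_fractionMn_eq0 // dvdn_mull.
Qed.

Section DecompositionIso.
Variables (p : nat) (G : topologicalZmodType).
Hypotheses (p_pr : prime p) (hG : prop_group p G).
Hypothesis inf_height_div : forall a : dual G,
  (forall k, multiples (dual G) (p ^ k) a) ->
  exists2 b : dual G, (forall k, multiples (dual G) (p ^ k) b) & b *+ p = a.
Variables (I : Type) (kappa : I -> nat).
Hypothesis kappa_inj : injective kappa.
Hypothesis kappa_height : forall k (a : dual G), a *+ p = 0 ->
  multiples (dual G) (p ^ k) a -> ~ multiples (dual G) (p ^ k.+1) a ->
  exists i, kappa i = k.

(** [alpha i] counts the basis elements of height [kappa i], and [X] is the set of those of infinite
    height. The first clause of the conclusion serves to show [X] empty when no nonzero character
    has infinite height. *)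
Lemma prop_group_decomposition : exists (alpha : I -> countable_cardinal) (X : Type),
  (X -> exists2 a : dual G, a <> 0 & forall k, multiples (dual G) (p ^ k) a) /\
  topgroup_iso G
    (prod_topology (fun i : I =>
       {ptws cardinal_type (alpha i) -> cyclic_group (p ^ (kappa i).+1)})
     * {ptws X -> padic_int p})%type.
Proof.
have [e eP] := dual_enumeration hG.
have [x [xp xv xe]] := valuated_sequence p_pr e.
have x_socle (a : dual G) : a *+ p = 0 -> exists n, spanned x n a.
  by have [n <-] := eP a => /xe; exists n.+1.
have [y [z [yx zP]]] := @division_sequences p G x inf_height_div.
have zx n (ninf : infinite_height p x n) : z n 0%N = x n by case: (zP _ ninf).
have zz n (ninf : infinite_height p x n) j : z n j.+1 *+ p = z n j by case: (zP _ ninf).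
have z_ord n (ninf : infinite_height p x n) j : z n j *+ p ^ j.+1 = 0.
  have := chain_mul zz j 0 ninf; rewrite addn0 expnSr mulrnA => ->.
  by rewrite zx.
have y_ord n k : height_eq p x n k -> y n *+ p ^ k.+1 = 0.
  by move=> nk; rewrite expnSr mulrnA yx.
pose J i := [set n | height_eq p x n (kappa i)].
pose alpha i := projT1 (cid (countable_cardinal_of_set (J i))).
have [phi phiP] : exists phi : forall i, cardinal_type (alpha i) -> nat,
    forall i, injective (phi i) /\ range (phi i) = J i.
  exists (fun i => projT1 (cid (projT2 (cid (countable_cardinal_of_set (J i)))))).
  by move=> i; apply: projT2 (cid (projT2 (cid (countable_cardinal_of_set (J i))))).
have phiJ i j : height_eq p x (phi i j) (kappa i).
  have [_ phi_range] := phiP i.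
  by have : J i (phi i j) by rewrite -phi_range; exists j.
pose X : Type := {n | infinite_height p x n}.
have coh g (n : X) : @coherent p (fun j => residue p j (eval (z (sval n) j) g)).
  case: n => n ninf j /=; rewrite -residue_coherent // -eval_natmul ?zz //.
  by rewrite z_ord // eval0.
pose f (g : G) : prod_topology (fun i : I =>
       {ptws cardinal_type (alpha i) -> cyclic_group (p ^ (kappa i).+1)})
     * {ptws X -> padic_int p} :=
  (fun i j => residue p (kappa i) (eval (y (phi i j)) g),
   fun n => SigSub (mem_set (coh g n))).
exists alpha, X; split.
  by move=> [n [xn xinf]]; exists (x n).
have [cG _ _ _] := hG.
apply: (@compact_bijection_iso G _ f) => //.
- apply: pair_hausdorff; apply: prod_topology_hausdorff => i.
    by apply: prod_topology_hausdorff => j; apply: cyclic_group_hausdorff.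
  exact: padic_int_hausdorff.
- move=> g h; congr pair.
    apply: functional_extensionality_dep => i; apply/funext => j.
    rewrite evalB residueB //; rewrite -eval_natmul (y_ord _ _ (phiJ i j)) //.
  apply/funext => n; apply: val_inj; apply: functional_extensionality_dep => j.
  rewrite /= evalB residueB //; rewrite -eval_natmul z_ord //; exact: (svalP n).
- have c1 : continuous (fun g => (f g).1).
    apply: prod_topology_continuous => i.
    by apply: prod_topology_continuous => j; apply: residue_eval_continuous.
  have c2 : continuous (fun g => (f g).2).
    apply: prod_topology_continuous => n; apply: continuous_comp_initial.
    by apply: prod_topology_continuous => j; apply: residue_eval_continuous.
  by move=> g; exact: cvg_pair (c1 g) (c2 g).
- move=> g [fg1 fg2]; apply: (coordinates_injective p_pr hG xp xv x_socle yx zx zz).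
    move=> n k nk; have [_ xk xSk] := nk.
    have [i ik] := kappa_height (xp n) xk xSk.
    have [_ phi_range] := phiP i.
    have : J i n by rewrite /J /= ik.
    rewrite -phi_range => -[j _ jn]; rewrite -jn.
    apply: (residue_eq0 p_pr (k := kappa i)).
      by rewrite -eval_natmul (y_ord _ _ (phiJ i j)) eval0.
    exact: (congr1 (fun h : prod_topology (fun i : I =>
       {ptws cardinal_type (alpha i) -> cyclic_group (p ^ (kappa i).+1)}) => h i j) fg1).
  move=> n ninf j.
  apply: (residue_eq0 p_pr (k := j)); first by rewrite -eval_natmul z_ord // eval0.
  exact: (congr1 (fun h : {ptws X -> padic_int p} => val (h (exist _ n ninf)) j) fg2).
- move=> [w v].
  (* Cyclic coordinates are lifted to Q/Z. Injectivity of [kappa] and of each [phi i] ensures that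
     an index n receives only one value. *)
  have /choice[W WP] : forall n, exists q, (forall k, height_eq p x n k -> q *+ p ^ k.+1 = 0) /\
      forall i j, phi i j = n -> residue p (kappa i) q = w i j.
    move=> n; have [[i [j jn]]|noh] := pselect (exists i j, phi i j = n); last first.
      by exists 0; split=> [k nk|i j jn]; [rewrite mul0rn | case: noh; exists i, j].
    have [q qp qw] := residue_surj p_pr (w i j); exists q; split=> [k nk|i' j' jn'].
      by rewrite -(height_eq_uniq (phiJ i j) (_ : height_eq p x (phi i j) k)) ?jn.
    have ii' : i = i'.
      by apply: kappa_inj; apply: height_eq_uniq (phiJ i j) _; rewrite jn -jn'.
    subst i'; have [phi_inj _] := phiP i.
    by rewrite -(phi_inj j j') // jn jn'.
  have /choice[V VP] : forall n, exists q : nat -> rat_mod_int, forall ninf : infinite_height p x n,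
      [/\ q 0%N *+ p = 0, forall j, q j.+1 *+ p = q j
        & forall j, residue p j (q j) = val (v (exist _ n ninf)) j].
    move=> n; have [ninf|noinf] := pselect (infinite_height p x n); last by exists (fun=> 0).
    pose b := v (exist _ n ninf).
    have bP j : val b j = (nat_of_ord (val b j.+1))%:R by apply: (set_mem (valP b)).
    (* The residue b_j modulo p^(j+1) is lifted to b_j / p^(j+1), and coherence gives the
       divisibility relations. *)
    exists (fun j => unit_fraction p j.+1 *+ nat_of_ord (val b j)) => ninf'.
    have -> : ninf' = ninf by apply: Prop_irrelevance.
    rewrite -/b; split=> [|j|j].
    - rewrite mulrnAC; have /eqP -> : unit_fraction p 1 *+ p == 0.
        by rewrite unit_fractionMn_eq0 ?prime_gt0 // expn1.
      by rewrite mul0rn.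
    - by rewrite mulrnAC unit_fractionS ?prime_gt0 // [in RHS]bP unit_fraction_natr.
    - by rewrite residue_unit_fraction // natr_Zp.
  have [|||g [gW gV]] := coordinates_surjective p_pr hG xp xv yx zx zz (w := W) (v := V).
  + by move=> n k nk; have [Wp _] := WP n; apply: Wp.
  + by move=> n ninf; have [] := VP n ninf.
  + by move=> n ninf; have [] := VP n ninf.
  exists g; congr pair.
    apply: functional_extensionality_dep => i; apply/funext => j.
    rewrite /f /= (gW _ _ (phiJ i j)); have [_ Ww] := WP (phi i j).
    exact: Ww.
  apply/funext => -[n ninf]; apply: val_inj; apply: functional_extensionality_dep => j.
  by rewrite /= gV //; have [_ _ ->] := VP n ninf.
Qed.
End DecompositionIso.

(** * The decomposition for bounded torsion and for dense torsion *)

Lemma mulrn_coprime_eq0 (G : zmodType) (g : G) m n : (0 < m)%N -> coprime m n ->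
  g *+ m = 0 -> g *+ n = 0 -> g = 0.
Proof.
move=> m0 mn gm gn; have [u v uv _] := egcdnP n m0.
have : g *+ (u * m) = 0 by rewrite mulnC mulrnA gm mul0rn.
by rewrite uv (eqP mn) mulrnDr mulnC mulrnA gn mul0rn add0r mulr1n.
Qed.

Lemma torsion_exponent p (G : topologicalZmodType) : prime p -> prop_group p G ->
  finite_exponent (torsion G) ->
  exists n, torsion G = [set g | g *+ p ^ n = 0].
Proof.
move=> p_pr hG [N N0 TN]; have [m pm NE] := pfactor_coprime p_pr N0.
exists (logn p N); apply/seteqP; split=> g; last first.
  by exists (p ^ logn p N)%N; rewrite // expn_gt0 prime_gt0.
move=> Tg; have [k gk] := torsion_p_torsion p_pr hG Tg.
have m0 : (0 < m)%N by move: N0; rewrite NE muln_gt0 => /andP[].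
apply: (@mulrn_coprime_eq0 _ _ m (p ^ k) m0).
- by rewrite coprime_sym coprimeXl.
- by rewrite -mulrnA mulnC -NE TN.
- by rewrite mulrnAC gk mul0rn.
Qed.

Lemma natmul_kernel_closed (G : topologicalZmodType) n : hausdorff_space G ->
  closed [set g : G | g *+ n = 0].
Proof.
move=> hausG; apply: (@preimage_closed _ _ (fun g : G => g *+ n) [set 0]).
  by move=> g _; apply: topgroup_natmul_continuous.
exact: accessible_closed_set1 (hausdorff_accessible hausG) 0.
Qed.

Lemma prop_group_finite_exponent p (G : topologicalZmodType) :
  prime p -> prop_group p G -> finite_exponent (torsion G) ->
  (subgroup (torsion G) /\ closed (torsion G)) /\
  exists (e : nat) (alpha : 'I_e -> countable_cardinal) (X : Type),
    (0 < e)%N /\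
    topgroup_iso G
      (prod_topology (fun i : 'I_e =>
         {ptws cardinal_type (alpha i) -> cyclic_group (p ^ i.+1)})
       * {ptws X -> padic_int p})%type.
Proof.
move=> p_pr hG /(torsion_exponent p_pr hG) [n TE].
have hausG : hausdorff_space G by case: hG.
split; first by split; [exact: torsion_subgroup | rewrite TE; apply: natmul_kernel_closed].
have kills_torsion (a : dual G) k : (n <= k)%N -> multiples (dual G) (p ^ k) a ->
    forall g l, g *+ p ^ l = 0 -> eval a g = 0.
  move=> nk ak g l gl; apply: (eval_multiples (multiples_exp_leq nk ak)).
  suff : torsion G g by rewrite TE.
  by exists (p ^ l)%N; rewrite // expn_gt0 prime_gt0.
(* A character of height at least n kills the torsion, hence is divisible by every power of p by
   [dual_divisible]. *)
have inf_height (a : dual G) k : (n <= k)%N -> multiples (dual G) (p ^ k) a ->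
    forall l, multiples (dual G) (p ^ l) a.
  move=> nk ak l; apply: (dual_divisible p_pr hG) => g gl.
  exact: kills_torsion nk ak g l gl.
(* Finite heights are below n; the index type has one more element so that the number of factors is
   positive even for n = 0. *)
have [|||alpha [X [_ iso]]] := @prop_group_decomposition p G p_pr hG _ 'I_n.+1 val.
(* Writing [a] as p^(n+1) b, the quotient p^n b has height at least n, hence infinite height. *)
- move=> a /(_ n.+1) [b <-]; exists (b *+ p ^ n); last by rewrite -mulrnA -expnSr.
  by apply: (inf_height _ n) => //; exists b.
- exact: val_inj.
- move=> k a _ ak aSk; have [kn|nk] := leqP k n; first by exists (inord k); rewrite /= inordK.
  by case: aSk; apply: inf_height ak _; apply: ltnW.
by exists n.+1, alpha, X.
Qed.

Lemma topgroup_iso_prod_void (G H : PreTopologicalZmodule.type) (X : Type)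
    (K : PreTopologicalZmodule.type) : (X -> False) ->
  topgroup_iso G (H * {ptws X -> K})%type -> topgroup_iso G H.
Proof.
move=> X0 [f [g [gf fg cf cg]]].
have void_eq (u v : {ptws X -> K}) : u = v by apply/funext => x; case: (X0 x).
pose f1 x := (f x).1.
have f1B : zmod_morphism f1 by move=> x y; rewrite /f1 raddfB.
pose fA := HB.pack_for {additive G -> H} f1 (GRing.isZmodMorphism.Build G H f1 f1B).
exists fA, (fun y => g (y, 0)); split.
- move=> x; rewrite -[RHS]gf; congr g.
  by rewrite [f x in RHS]surjective_pairing; congr pair; apply: void_eq.
- by move=> y; rewrite /= /f1 fg.
- move=> x; apply: (@continuous_comp _ _ _ f fst); first exact: cf.
  exact: cvg_fst.
- move=> y; apply: (@continuous_comp _ _ _ (fun y => (y, 0)) g); last exact: cg.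
  rewrite /continuous_at.
  apply: (@cvg_pair _ _ _ (nbhs y) (nbhs y) (nbhs (0 : {ptws X -> K})) _ _ _ id (cst 0)).
    exact: cvg_id.
  exact: cvg_cst.
Qed.

Lemma prod_topology_natmul (I : Type) (T : I -> zmodType) (f : prod_topology T) n i :
  (f *+ n) i = f i *+ n.
Proof. by elim: n => // n IHn; rewrite !mulrS -IHn. Qed.

Lemma prop_group_dense_torsion p (G : topologicalZmodType) :
  prime p -> prop_group p G -> closure (torsion G) = setT ->
  ~ finite_exponent (torsion G) ->
  exists alpha : nat -> countable_cardinal,
    not_tending_to_0 alpha /\
    topgroup_iso G
      (prod_topology (fun i : nat =>
         {ptws cardinal_type (alpha i) -> cyclic_group (p ^ i.+1)})).
Proof.
move=> p_pr hG dense infexp.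
(* Such a character kills every torsion element, and its kernel is closed. *)
have inf_height0 (a : dual G) : (forall k, multiples (dual G) (p ^ k) a) -> a = 0.
  move=> ainf; apply: dual_ext => g; rewrite eval0.
  apply: (@eval_closed _ a 0); have : closure (torsion G) g by rewrite dense.
  apply: closure_subset => h /(torsion_p_torsion p_pr hG) [k hk].
  exact: eval_multiples (ainf k) hk.
have [|||alpha [X [X0 iso]]] := @prop_group_decomposition p G p_pr hG _ nat id.
- move=> a /inf_height0 ->; exists 0; last by rewrite mul0rn.
  by move=> k; exists 0; rewrite mul0rn.
- by [].
- by move=> k a _ _ _; exists k.
have {}iso : topgroup_iso G (prod_topology (fun i : nat =>
         {ptws cardinal_type (alpha i) -> cyclic_group (p ^ i.+1)})).
  by apply: topgroup_iso_prod_void iso => /X0[a a0 /inf_height0].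
exists alpha; split=> // fin; apply: infexp.
have [f [g [gf _ _ _]]] := iso.
have [N NP] : exists N, forall i, alpha i <> Defs.Finite 0 -> (i <= N)%N.
  have /finite_seqP[r rE] := fin; exists (\max_(m <- r) m) => i ai.
  apply: (@leq_bigmax_seq _ r predT id) => //.
  by have : [set i | alpha i <> Defs.Finite 0] i by []; rewrite rE.
(* Nontrivial factors have index i at most [N] and exponent p^(i+1). *)
exists (p ^ N.+1)%N; first by rewrite expn_gt0 prime_gt0.
move=> x _; rewrite -[RHS](gf 0) -[LHS]gf; congr g; rewrite raddfMn raddf0.
apply: functional_extensionality_dep => i; apply/funext => j.
rewrite !prod_topology_natmul -[LHS]mulr_natr natr_Zp_exp_eq0 ?mulr0 //.
apply: dvdn_exp2l; rewrite ltnS; apply: NP => ai; move: j; rewrite ai.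
by case.
Qed.

(** * The abstract isomorphism *)

Lemma exists_ge_chain (P : nat -> nat -> Prop) :
  (forall k m, exists n, (m <= n)%N /\ P k n) ->
  exists nu : nat -> nat, injective nu /\ forall k, P k (nu k).
Proof.
move=> Pex; have /choice[s sP] : forall km : nat * nat, exists n, (km.2 <= n)%N /\ P km.1 n.
  by move=> [k m]; apply: Pex.
pose nu := fix nu k := if k is j.+1 then s (j.+1, (nu j).+1) else s (0, 0)%N.
have nuP k : P k (nu k).
  by case: k => [|k]; [have [] := sP (0, 0)%N | have [] := sP (k.+1, (nu k).+1)].
have nu_lt k l : (k < l)%N -> (nu k < nu l)%N.
  elim: l => // l IHl; rewrite ltnS leq_eqVlt => /predU1P[->|/IHl kl].
    by have [] := sP (l.+1, (nu l).+1).
  by apply: ltn_trans kl _; have [] := sP (l.+1, (nu l).+1).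
exists nu; split=> // k l kl; apply/eqP; rewrite eqn_leq; apply/andP; split;
  by rewrite leqNgt; apply/negP => /nu_lt; rewrite kl ltnn.
Qed.

(** * Continuum many independent classes modulo t(G) + pG *)

Section InfiniteExponent.
Variables (p : nat) (G : topologicalZmodType).
Hypotheses (p_pr : prime p) (hG : prop_group p G).
Hypothesis infexp : ~ finite_exponent (torsion G).

Let p_gt0 : (0 < p)%N. Proof. exact: prime_gt0. Qed.
Let cG : compact [set: G]. Proof. by case: hG. Qed.
Local Notation A := (dual G).

(** Otherwise, from some k on, socle elements of height at least k have infinite height. Then p^k A
    = p^(k+1) A, and dually p^k kills the torsion of [G]. *)
Lemma unbounded_heights (x : nat -> A) : (forall n, x n *+ p = 0) ->
  (forall n, valuated_step p x n) ->
  (forall a : A, a *+ p = 0 -> exists n, spanned x n a) ->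
  forall k m, exists n, (m <= n)%N /\ (x n <> 0 /\ multiples A (p ^ k) (x n)).
Proof.
move=> xp xv x_socle k0 m0; apply: contrapT => no_n; apply: infexp.
have /choice[h hP] : forall n, exists h,
    ~ multiples A (p ^ h) (x n) \/ forall l, multiples A (p ^ l) (x n).
  move=> n; have [[h hn]|noh] := pselect (exists h, ~ multiples A (p ^ h) (x n)).
    by exists h; left.
  by exists 0%N; right=> l; apply: contrapT => nl; apply: noh; exists l.
(* Large enough to exclude nonzero terms of index at least [m0], and those of smaller index and
   finite height. *)
pose k := (k0 + \max_(n < m0) h n)%N.
have x_inf n : x n <> 0 -> multiples A (p ^ k) (x n) -> forall l, multiples A (p ^ l) (x n).
  move=> xn xk; have [m0n|nm0] := leqP m0 n.
    case: no_n; exists n; split=> //; split=> //.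
    by apply: multiples_exp_leq xk; apply: leq_addr.
  have [hn|//] := hP n; case: hn; apply: multiples_exp_leq xk.
  by rewrite (leq_trans (@leq_bigmax _ (fun i : 'I_m0 => h i) (Ordinal nm0))) // leq_addl.
clearbody k.
have socle_inf (a : A) : a *+ p = 0 -> multiples A (p ^ k) a ->
    forall l, multiples A (p ^ l) a.
  move=> /x_socle[N [c ->]] ak l; apply: subgroup_sum => [|i _].
    exact: multiples_subgroup.
  have := valuated_multiples p_pr xp xv ak (ltn_ord i).
  have [->|xc] := pselect (x i *+ c i = 0); first by exists 0; rewrite mul0rn.
  have [d dE] := mulrn_prime_inv p_pr (xp i) xc.
  move=> xck; apply: subgroupMn; first exact: multiples_subgroup.
  apply: x_inf; first by move=> xi; rewrite xi mul0rn in xc.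
  by rewrite -(dE _ (xp i)); apply: subgroupMn xck; apply: multiples_subgroup.
(* Induction on the order of [a]: its last nonzero p-power multiple has infinite height, so an
   element of p^(k+1) A can be subtracted to lower the order. *)
have step (a : A) : multiples A (p ^ k) a -> multiples A (p ^ k.+1) a.
  have [m] := dual_p_torsion hG a; elim: m a => [|m IHm] a.
    by rewrite mulr1n => -> _; exists 0; rewrite mul0rn.
  move=> am ak.
  have [||b bE] := socle_inf (a *+ p ^ m) _ _ (m + k.+1)%N.
  - by rewrite -mulrnA -expnSr.
  - by apply: subgroupMn => //; apply: multiples_subgroup.
  have bk : multiples A (p ^ k.+1) (b *+ p ^ k.+1) by exists b.
  rewrite -[a](subrK (b *+ p ^ k.+1)).
  apply: subgroupD => //; first exact: multiples_subgroup.
  apply: IHm; first by rewrite mulrnBl -[X in _ - X]mulrnA -expnD addnC bE subrr.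
  by apply: subgroupB => //; [exact: multiples_subgroup | exact: multiples_expS].
have tor l (g : G) : g *+ p ^ l = 0 -> g *+ p ^ k = 0.
  elim: l g => [|l IHl] g gl.
    by have -> : g = 0 by []; rewrite mul0rn.
  have [kl|lk] := leqP k l; last first.
    by rewrite -(subnKC lk) expnD mulrnA gl mul0rn.
  apply: IHl; apply: (eval_multiples_eq0 p_pr hG) => _ [b <-].
  have [|c cE] := step (b *+ p ^ k); first by exists b.
  apply: (eval_multiples _ gl); exists c.
  by rewrite -(subnKC kl) -addSn !expnD !mulrnA cE.
exists (p ^ k)%N; first by rewrite expn_gt0 p_gt0.
by move=> g /(torsion_p_torsion p_pr hG) [l /tor].
Qed.

Definition torsion_plus_p : set G :=
  [set g | exists t h, torsion G t /\ g = t + h *+ p].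

Lemma torsion_plus_p_subgroup : subgroup torsion_plus_p.
Proof.
have sT := torsion_subgroup G.
apply: subgroupP => [|_ _ [t [h [Tt ->]]] [t' [h' [Tt' ->]]]].
  by exists 0, 0; rewrite mul0rn addr0; split=> //; apply: subgroup0 sT.
exists (t - t'), (h - h'); split; first exact: subgroupB.
by rewrite mulrnBl opprD addrACA.
Qed.

(* The sets of codes of the finite prefixes of [f : nat -> bool] form an almost
   disjoint family; [b f] takes a non-zero value exactly on the characters
   [x (nu j)] with [j] in the set attached to [f], whereas an element of
   [torsion_plus_p] is killed by almost all of them. *)
Lemma continuum_independent_family : exists b : (nat -> bool) -> G,
  forall (r : seq (nat -> bool)) (c : (nat -> bool) -> int), uniq r ->
    torsion_plus_p (\sum_(f <- r) b f *~ c f) -> forall f, f \in r -> (p %| c f)%Z.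
Proof.
have [e eP] := dual_enumeration hG.
have [x [xp xv xe]] := valuated_sequence p_pr e.
have x_socle (a : A) : a *+ p = 0 -> exists n, spanned x n a.
  by have [n <-] := eP a => /xe; exists n.+1.
have [nu [nu_inj nuP]] := exists_ge_chain (unbounded_heights xp xv x_socle).
pose code (f : nat -> bool) k := pickle (mkseq f k).
have code_inj f f' k k' : code f k = code f' k' ->
    k = k' /\ forall i, (i < k)%N -> f i = f' i.
  move=> /(pcan_inj pickleK) ff'.
  have kk' : k = k' by rewrite -(size_mkseq f k) ff' size_mkseq.
  split=> // i ik; rewrite -(nth_mkseq false f ik) ff' nth_mkseq // -kk'.
  by [].
pose gamma := unit_fraction p 1.
have gamma_p : gamma *+ p = 0.
  by apply/eqP; rewrite unit_fractionMn_eq0 // expn1.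
pose u f n := if `[< exists k, n = nu (code f k) >] then gamma else 0.
have /choice[b bP] : forall f, exists g, forall n, eval (x n) g = u f n.
  move=> f; apply: compact_nested => // [n|N]; first exact: eval_closed.
  apply: (socle_interpolation p_pr xp (valuated_independent p_pr xp xv)) => n.
    by rewrite /u; case: ifP => _; rewrite ?mul0rn.
  rewrite /u; case: asboolP => // -[k ->] xn0.
  by have [] := nuP (code f k).
exists b => r c r_uniq [t [h [Tt sumE]]] f0 f0r.
have [m tm] := torsion_p_torsion p_pr hG Tt.
have [K0 K0P] : exists K0, forall f, f \in r -> f <> f0 ->
    exists2 i, (i < K0)%N & f i <> f0 i.
  have /choice[d dP] : forall f : nat -> bool, exists i, f <> f0 -> f i <> f0 i.
    move=> f; have [ff0|/existsNP[i fi]] := pselect (forall i, f i = f0 i).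
      by exists 0%N; case; apply/funext.
    by exists i.
  exists (\max_(f <- r) d f).+1 => f fr ff0; exists (d f); last exact: dP.
  by rewrite ltnS; apply: (@leq_bigmax_seq _ r predT d).
(* From length [K0] on, the prefixes of [f0] differ from those of the other members of [r]; the
   length is increased until the code exceeds [m]. The corresponding character then kills the
   torsion part [t] and every [b f] in the sum except [b f0]. *)
have [k mk] : exists k, (m < code f0 (K0 + k))%N.
  by apply: injective_gtn => i j /code_inj [/addnI].
set K := (K0 + k)%N in mk; set j := code f0 K.
have [_ xj] := nuP j.
have mj : (m <= j)%N by apply: ltnW.
have : eval (x (nu j)) (\sum_(f <- r) b f *~ c f) = 0.
  rewrite sumE evalD evalMn -eval_natmul xp eval0 addr0.
  apply: (eval_multiples xj); rewrite -(subnKC mj) expnD mulrnA tm mul0rn.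
  by [].
rewrite eval_sumr (bigD1_seq f0) //= big_seq_cond big1 ?addr0; last first.
  move=> f /andP[fr /eqP ff0]; rewrite evalMz bP /u; case: asboolP; rewrite ?mul0rz //.
  case=> k' /nu_inj /esym /code_inj [kK fE]; have [i iK0 []] := K0P f fr ff0.
  by apply: fE; rewrite kK /K ltn_addr.
rewrite evalMz bP /u; case: asboolP => [_|[]]; last by exists K.
move=> gc; rewrite dvdzE -[`|p|%N]expn1 -unit_fractionMn_eq0 // -/gamma.
by case: (c f0) gc => n /=; rewrite ?NegzE ?mulrNz -?pmulrn => /eqP; rewrite ?oppr_eq0.
Qed.

End InfiniteExponent.

(** * Bases of an elementary abelian quotient *)

Section ModPBasis.
Variables (p : nat) (G : zmodType) (N : set G).
Hypotheses (p_pr : prime p) (sN : subgroup N) (Np : forall g, N (g *+ p)).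

(** Linear independence over F_p in the quotient by [N], expressed through representatives and
    integer coefficients. *)
Definition mod_p_free (S : set G) := forall (r : seq G) (c : G -> int),
  uniq r -> (forall x, x \in r -> S x) -> N (\sum_(x <- r) x *~ c x) ->
  forall x, x \in r -> (p %| c x)%Z.

Definition mod_p_generating (S : set G) := forall g, exists (r : seq G) (c : G -> int),
  [/\ uniq r, forall x, x \in r -> S x & N (g - \sum_(x <- r) x *~ c x)].

Lemma chain_finite_sub (F : set (set G)) (S0 : set G) (r : seq G) :
  total_on F subset -> (exists X, F X) ->
  (forall x, x \in r -> (S0 `|` \bigcup_(X in F) X) x) ->
  exists2 X, F X & forall x, x \in r -> (S0 `|` X) x.
Proof.
move=> Ftot F0; elim: r => [|x r IHr] rF.
  by have [X FX] := F0; exists X.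
have [|X FX rX] := IHr; first by move=> z zr; apply: rF; rewrite inE zr orbT.
have [S0x|[Y FY Yx]] := rF x (mem_head _ _).
  by exists X => // z; rewrite inE => /predU1P[->|/rX]; [left | ].
have [XY|YX] := Ftot _ _ FX FY.
  exists Y => // z; rewrite inE => /predU1P[->|/rX]; first by right.
  by case=> [|/XY]; [left | right].
by exists X => // z; rewrite inE => /predU1P[->|/rX//]; right; apply: YX.
Qed.

(** A maximal free set generates: an element [g] outside its span can be adjoined, for a relation in
    which the coefficient of [g] is prime to p would express [g] through the others. *)
Lemma mod_p_basis_exists (S0 : set G) : mod_p_free S0 ->
  exists S, [/\ S0 `<=` S, mod_p_free S & mod_p_generating S].
Proof.
move=> free0; pose P := [set X : set G | mod_p_free (S0 `|` X)].
have [F FP Ftot|A [freeA Amax]] := @Zorn_bigcup _ P.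
  have [->|/set0P F0] := eqVneq F set0.
    by rewrite /P /= bigcup_set0 setU0.
  move=> r c r_uniq rF; have [X FX rX] := chain_finite_sub Ftot F0 rF.
  exact: FP _ FX r c r_uniq rX.
set S := S0 `|` A in freeA; exists S; split=> // [|g]; first exact: subsetUl.
apply: contrapT => ngen.
have gS : ~ S g.
  move=> Sg; apply: ngen; exists [:: g], (fun=> 1); split=> //.
    by move=> x; rewrite inE => /eqP->.
  by rewrite big_seq1 mulr1z subrr; apply: subgroup0 sN.
apply: (Amax (A `|` [set g])).
  split; first exact: subsetUl.
  by move=> /(_ g) sub; apply: gS; right; apply: sub; right.
rewrite /P /= setUA -/S => r c r_uniq rS sumN.
have sub_rem x : x \in rem g r -> S x.
  rewrite mem_rem_uniq // inE => /andP[/eqP xg /rS [//|/= xg']].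
  by case: xg.
have [gr|gr] := boolP (g \in r); last first.
  apply: freeA sumN => // x xr; have [//|/= xg] := rS x xr.
  by move: gr; rewrite -xg xr.
move: sumN; rewrite (perm_big _ (perm_to_rem gr)) big_cons => sumN.
have pcg : (p %| c g)%Z.
  apply: contrapT => /negP pcg; apply: ngen.
  have : coprimez p (c g) by rewrite coprimezE /= prime_coprime.
  move=> /coprimezP[[u v] /= uv].
  exists (rem g r), (fun x => - (c x * v)); split=> //; first exact: rem_uniq.
  (* With u p + v c(g) = 1, the difference is a multiple of p plus v times the given relation, both
     in [N]. *)
  have -> : g - \sum_(x <- rem g r) x *~ (- (c x * v)) =
      (g *~ u) *+ p + (g *~ c g + \sum_(x <- rem g r) x *~ c x) *~ v.
    have -> : \sum_(x <- rem g r) x *~ (- (c x * v)) = - ((\sum_(x <- rem g r) x *~ c x) *~ v).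
      by rewrite mulrz_suml -sumrN; apply: eq_bigr => x _; rewrite mulrNz mulrzA.
    rewrite opprK mulrzDl addrA; congr (_ + _).
    by rewrite pmulrn -!mulrzA -mulrzDr [c g * v]mulrC uv mulr1z.
  by apply: subgroupD => //; apply: subgroupMz.
have sumN' : N (\sum_(x <- rem g r) x *~ c x).
  have /dvdzP[q qE] := pcg.
  have := subgroupB sN sumN (Np (g *~ q)).
  by rewrite pmulrn -mulrzA -qE addrAC subrr add0r.
move=> x xr; have [->//|xg] := eqVneq x g.
apply: (freeA (rem g r) c) => //; first exact: rem_uniq.
by rewrite mem_rem_uniq // inE xg.
Qed.

End ModPBasis.

Section Cardinality.
Variables (p : nat) (G : topologicalZmodType).
Hypotheses (p_pr : prime p) (hG : prop_group p G).

(** An element is determined by its cosets modulo all [U n]; the positions of these in the finite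
    transversals are coded by a subset of N. *)
Lemma prop_group_card_le : ([set: G] #<= [set: nat -> bool])%card.
Proof.
have [U [r [sU U0 UV rP]]] := countable_filtration hG.
pose pos g n := find (fun x => `[< U n (g - x) >]) (r n).
have pos_inj g h : pos g =1 pos h -> g = h.
  move=> gh; have hausG : hausdorff_space G by case: hG.
  apply: hausG => V W Vg Wh; exists h; split; last exact: nbhs_singleton.
  have [n UnV] : exists n, U n `<=` [set y | V (y + g)].
    by apply: UV; apply: (@translation_continuous G g); rewrite add0r.
  suff : U n (h - g) by move=> /UnV; rewrite /= subrK.
  have near_pos k : U n (k - nth 0 (r n) (pos k n)).
    apply/asboolP; apply: (@nth_find _ 0 (fun x => `[< U n (k - x) >])).
    by have [x xr Ux] := rP n k; apply/hasP; exists x => //; apply/asboolP.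
  have := subgroupB (sU n) (near_pos h) (near_pos g); rewrite gh.
  by rewrite opprB addrA subrK.
pose code g m := if unpickle m is Some ij then pos g (ij : nat * nat).1 == ij.2 else false.
have code_inj : injective code.
  move=> g h gh; apply: pos_inj => n.
  have := congr1 (fun f => f (pickle (n, pos g n))) gh.
  by rewrite /code pickleK /= eqxx => /esym/eqP.
have := inj_card_eq (in2W code_inj : {in setT &, injective code}).
rewrite card_eq_le => /andP[_ /card_le_trans]; apply.
exact: card_leT.
Qed.

Hypothesis infexp : ~ finite_exponent (torsion G).

Lemma torsion_plus_p_natmul g : @torsion_plus_p p G (g *+ p).
Proof.
by exists 0, g; rewrite add0r; split=> //; apply: subgroup0 (torsion_subgroup G).
Qed.

(** The basis extends the independent family and lies in [G], so it is bounded on both sides by the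
    continuum. The exact cardinality allows bases of two different groups to be matched. *)
Lemma continuum_basis : exists S : set G, [/\ (S #= [set: nat -> bool])%card,
  mod_p_free p (@torsion_plus_p p G) S & mod_p_generating (@torsion_plus_p p G) S].
Proof.
have [b bP] := continuum_independent_family p_pr hG infexp.
have sN := torsion_plus_p_subgroup p G.
have b_inj : injective b.
  move=> f f' ff'; apply/eqP/negPn/negP => ff.
  have := bP [:: f; f'] (fun h => if h == f then 1 else -1).
  rewrite /= inE ff big_cons big_seq1 eqxx eq_sym (negPf ff) mulr1z mulrN1z ff' subrr.
  move=> /(_ isT (subgroup0 sN) f (mem_head _ _)); rewrite eqxx dvdzE /= dvdn1.
  by case: p p_pr => [|[]].
have [|S [bS freeS genS]] := @mod_p_basis_exists p G _ p_pr sN torsion_plus_p_natmul (range b).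
  move=> r c r_uniq rb sumN x xr.
  pose inv y := xget (fun=> false) [set f | b f = y].
  have invK : {in r, cancel inv b}.
    by move=> y /rb [f _ fy]; apply: (@xgetI _ (fun=> false) [set f | b f = y] f).
  rewrite -(invK x xr); apply: (bP (map inv r) (c \o b)) => /=.
  - by rewrite map_inj_in_uniq // => y z yr zr yz; rewrite -(invK y yr) yz invK.
  - rewrite big_map; congr (@torsion_plus_p p G _): sumN.
    by apply: eq_big_seq => y yr; rewrite invK.
  - exact: map_f.
exists S; split=> //; rewrite card_eq_le; apply/andP; split.
  exact: card_le_trans (card_leT _) prop_group_card_le.
have := inj_card_eq (in2W b_inj : {in setT &, injective b}).
rewrite card_eq_le => /andP[_ /card_le_trans]; apply.
exact: subset_card_le.
Qed.

End Cardinality.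

Lemma sum_uniq_sub (G : zmodType) (I : eqType) (r s : seq I) (F : I -> G) :
  uniq r -> uniq s -> {subset r <= s} -> (forall i, i \notin r -> F i = 0) ->
  \sum_(i <- s) F i = \sum_(i <- r) F i.
Proof.
move=> r_uniq s_uniq rs F0.
rewrite (bigID (mem r)) /= [X in _ + X]big1 // addr0 -big_filter.
apply: perm_big; apply: uniq_perm; rewrite ?filter_uniq // => i.
by rewrite mem_filter; apply: andb_idr; apply: rs.
Qed.

(** * Extending an isomorphism of torsion subgroups *)

Section PairedSubgroup.
Variables (G H : zmodType) (I : choiceType).
Variables (Theta : set (G * H)) (b : I -> G) (b' : I -> H).
Hypothesis sTheta : subgroup Theta.

(* The requirement that [c] vanish off [r] lets two such sums be compared over
   a common index sequence. *)
Definition comb_pair : set (G * H) := [set xy | exists ts (r : seq I) (c : I -> int),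
  [/\ Theta ts, uniq r, forall i, i \notin r -> c i = 0
    & xy = ts + \sum_(i <- r) (b i, b' i) *~ c i]].

Lemma comb_pair_subgroup : subgroup comb_pair.
Proof.
apply: subgroupP => [|_ _ [t [r [c [Tt ur c0 ->]]]] [t' [r' [c' [Tt' ur' c'0 ->]]]]].
  exists 0, [::], (fun=> 0); rewrite big_nil addr0; split=> //; exact: subgroup0 sTheta.
exists (t - t'), (undup (r ++ r')), (fun i => c i - c' i); split.
- exact: subgroupB.
- exact: undup_uniq.
- by move=> i; rewrite mem_undup mem_cat negb_or => /andP[/c0 -> /c'0 ->]; rewrite subrr.
have F0 (d : I -> int) i : d i = 0 -> (b i, b' i) *~ d i = 0 by move=> ->; rewrite mulr0z.
rewrite -(@sum_uniq_sub _ _ r (undup (r ++ r')) (fun i => (b i, b' i) *~ c i)) ?undup_uniq //.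
- rewrite -(@sum_uniq_sub _ _ r' (undup (r ++ r')) (fun i => (b i, b' i) *~ c' i)) ?undup_uniq //.
  + rewrite opprD addrACA; congr (_ + _).
    by rewrite -sumrB; apply: eq_bigr => i _; rewrite mulrzBr.
  + by move=> i ir; rewrite mem_undup mem_cat ir orbT.
  + by move=> i /c'0 /F0.
- by move=> i ir; rewrite mem_undup mem_cat ir.
- by move=> i /c0 /F0.
Qed.

End PairedSubgroup.

Lemma pairD (G H : zmodType) (x : G) (y : H) x' y' :
  (x, y) + (x', y') = (x + x', y + y').
Proof. by []. Qed.

Lemma comb_pairE (G H : zmodType) (I : eqType) (b : I -> G) (b' : I -> H) r (c : I -> int) :
  \sum_(i <- r) (b i, b' i) *~ c i = (\sum_(i <- r) b i *~ c i, \sum_(i <- r) b' i *~ c i).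
Proof.
elim: r => [|i r IHr]; first by rewrite !big_nil.
by rewrite !big_cons IHr pairMz.
Qed.

Section AdicExtension.
Variables (p : nat) (G H : zmodType) (I : choiceType).
Variables (Theta : set (G * H)) (b : I -> G) (b' : I -> H).
Hypothesis p_gt0 : (0 < p)%N.
Hypothesis sTheta : subgroup Theta.
Hypothesis Theta_torsion : forall t s, Theta (t, s) -> torsion G t.
Hypothesis Theta_total : forall t, torsion G t -> exists s, Theta (t, s).
Hypothesis Theta_fun : forall s, Theta (0, s) -> s = 0.
Hypothesis b_free : forall (r : seq I) (c : I -> int), uniq r ->
  (exists t h, torsion G t /\ \sum_(i <- r) b i *~ c i = t + h *+ p) ->
  forall i, i \in r -> (p %| c i)%Z.
Hypothesis b_gen : forall g, exists (r : seq I) (c : I -> int) t h,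
  [/\ uniq r, torsion G t & g = t + \sum_(i <- r) b i *~ c i + h *+ p].
Hypothesis H_sep : forall h, (forall n, multiples H (p ^ n) h) -> h = 0.
Hypothesis H_complete : forall s : nat -> H,
  (forall n, multiples H (p ^ n) (s n.+1 - s n)) ->
  exists h, forall n, multiples H (p ^ n) (h - s n).

Local Notation K := (comb_pair Theta b b').
Let sK : subgroup K. Proof. exact: comb_pair_subgroup. Qed.
Let sT := torsion_subgroup G.

Let torsion_div g : torsion G (g *+ p) -> torsion G g.
Proof.
move=> [n n0 gn]; exists (p * n)%N; first by rewrite muln_gt0 p_gt0.
by rewrite mulrnA.
Qed.

(** Freeness makes the coefficients divisible by p. What remains on the left is a torsion element
    divisible by p, whose p-th part is again torsion and is carried across by [Theta]. *)
Lemma comb_pair_divp g h : K (g *+ p, h) -> exists g' h', [/\ K (g', h'),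
  g *+ p = g' *+ p & h = h' *+ p].
Proof.
move=> [[t s] [r [c [Tts r_uniq c0]]]]; rewrite comb_pairE pairD => -[gE hE].
have Tt := Theta_torsion Tts.
have c_dvd i : (p %| c i)%Z.
  have [ir|/c0 -> //] := boolP (i \in r).
  apply: (b_free r_uniq) ir; exists (- t), g; split; first exact: subgroupN.
  by rewrite gE addKr.
have /choice[d dE] : forall i, exists d : int, c i = d * p%:Z.
  by move=> i; have /dvdzP[q ->] := c_dvd i; exists q.
have d0 i : i \notin r -> d i = 0.
  move=> /c0 /eqP; rewrite dE mulf_eq0 eqz_nat => /orP[/eqP //|/eqP p0].
  by move: p_gt0; rewrite p0.
have sumE (M : zmodType) (a : I -> M) :
    \sum_(i <- r) a i *~ c i = (\sum_(i <- r) a i *~ d i) *+ p.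
  by rewrite -sumrMnl; apply: eq_bigr => i _; rewrite dE mulrzA pmulrn.
pose u := g - \sum_(i <- r) b i *~ d i.
have up : u *+ p = t by rewrite mulrnBl -sumE gE addrK.
have [v Tuv] : exists v, Theta (u, v).
  by apply/Theta_total/torsion_div; rewrite up.
have vp : v *+ p = s.
  apply/eqP; rewrite eq_sym -subr_eq0; apply/eqP/Theta_fun.
  have := subgroupB sTheta Tts (subgroupMn sTheta p Tuv).
  by rewrite pairMn -[_ - _]/(_ - _, _ - _) /= up subrr.
exists (u + \sum_(i <- r) b i *~ d i), (v + \sum_(i <- r) b' i *~ d i); split.
- exists (u, v), r, d; split=> //; rewrite comb_pairE pairD.
  by [].
- by rewrite subrK.
- by rewrite mulrnDl vp -sumE.
Qed.

Lemma comb_pair_div n g h : K (g *+ p ^ n, h) -> exists g' h', [/\ K (g', h'),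
  g *+ p ^ n = g' *+ p ^ n & h = h' *+ p ^ n].
Proof.
elim: n g h => [|n IHn] g h Kgh; first by exists g, h; rewrite !mulr1n.
(* [g1] may differ from p^n g by an element [u] killed by p; subtracting [u] and its partner [v]
   corrects this without changing the p-th multiples. *)
have [|g1 [h1 [K1 gE hE]]] := @comb_pair_divp (g *+ p ^ n) h.
  by rewrite -mulrnA -expnSr.
pose u := g1 - g *+ p ^ n.
have up : u *+ p = 0 by rewrite mulrnBl gE subrr.
have [v Tuv] : exists v, Theta (u, v).
  by apply/Theta_total/torsion_div; rewrite up; apply: subgroup0 sT.
have vp : v *+ p = 0.
  apply: Theta_fun; have := subgroupMn sTheta p Tuv.
  by rewrite pairMn up.
have Kuv : K (u, v).
  by exists (u, v), [::], (fun=> 0); rewrite big_nil addr0.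
have [|g2 [h2 [K2 gE2 hE2]]] := IHn g (h1 - v).
  by have := subgroupB sK K1 Kuv; rewrite -[_ - _]/(_ - _, _ - _) /= opprB addrCA subrr addr0.
exists g2, h2; split=> //.
  by rewrite expnSr !mulrnA gE2.
by rewrite expnSr mulrnA -hE2 mulrnBl vp subr0.
Qed.

(** Generation modulo p is applied again and again to the remainder. *)
Lemma comb_pair_dense n g : exists x y, K (x, y) /\ multiples G (p ^ n) (g - x).
Proof.
elim: n => [|n [x [y [Kxy [g' g'E]]]]].
  by exists 0, 0; split; [exact: subgroup0 sK | exists g; rewrite subr0].
have [r [c [t [h [r_uniq Tt gE]]]]] := b_gen g'.
have [s Tts] := Theta_total Tt.
pose c' i := if i \in r then c i else 0.
have c'E (M : zmodType) (a : I -> M) : \sum_(i <- r) a i *~ c i = \sum_(i <- r) a i *~ c' i.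
  by apply: eq_big_seq => i ir; rewrite /c' ir.
pose x1 := t + \sum_(i <- r) b i *~ c' i.
pose y1 := s + \sum_(i <- r) b' i *~ c' i.
have K1 : K (x1, y1).
  exists (t, s), r, c'; split=> //; last by rewrite comb_pairE pairD.
  by move=> i /negPf; rewrite /c' => ->.
exists (x + x1 *+ p ^ n), (y + y1 *+ p ^ n); split.
  have := subgroupD sK Kxy (subgroupMn sK (p ^ n) K1).
  by rewrite pairMn.
exists h; rewrite opprD addrA -g'E -mulrnBl gE c'E /x1 addrAC subrr add0r.
by rewrite -mulrnA -expnS.
Qed.

Definition adic_closure : set (G * H) := [set gh | forall n, exists x y,
  [/\ K (x, y), multiples G (p ^ n) (gh.1 - x) & multiples H (p ^ n) (gh.2 - y)]].

Lemma adic_closure_subgroup : subgroup adic_closure.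
Proof.
apply: subgroupP => [n|[g h] [g' h'] Rgh Rgh' n].
  by exists 0, 0; split; [exact: subgroup0 sK | |]; rewrite subrr;
    apply: subgroup0 (multiples_subgroup _ _).
have [x [y [Kxy gx hy]]] := Rgh n; have [x' [y' [Kxy' gx' hy']]] := Rgh' n.
exists (x - x'), (y - y'); split; first by have := subgroupB sK Kxy Kxy'.
  have := subgroupB (multiples_subgroup G (p ^ n)) gx gx'.
  by rewrite /= !opprD !opprK addrACA.
have := subgroupB (multiples_subgroup H (p ^ n)) hy hy'.
by rewrite /= !opprD !opprK addrACA.
Qed.

(** Approximate [g] by first components of pairs in [K]. By [comb_pair_div] the second components
    form a p-adic Cauchy sequence, whose limit is the image. *)
Lemma adic_closure_total g : exists h, adic_closure (g, h).
Proof.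
have /choice[x /choice[y xyP]] := comb_pair_dense^~ g.
have [n|h hP] := H_complete (s := y).
  have [Kxy [u uE]] := xyP n; have [Kxy' [v vE]] := xyP n.+1.
  have := subgroupB sK Kxy' Kxy.
  have -> : (x n.+1, y n.+1) - (x n, y n) = ((u - v *+ p) *+ p ^ n, y n.+1 - y n).
    rewrite -[LHS]/(_ - _, _ - _) /=; congr pair.
    by rewrite mulrnBl -mulrnA -expnS uE vE opprB [RHS]addrC subrKA.
  by move=> /comb_pair_div [_ [w [_ _ ->]]]; exists w.
exists h => n; have [Kxy gx] := xyP n; exists (x n), (y n); split=> //.
Qed.

(** By [comb_pair_div] the approximations of [h] are as divisible as those of 0, so [h] is divisible
    by every power of p. *)
Lemma adic_closure_fun h : adic_closure (0, h) -> h = 0.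
Proof.
move=> R0h; apply: H_sep => n; have [x [y [Kxy [u uE] hy]]] := R0h n.
have : K ((- u) *+ p ^ n, y) by rewrite mulNrn uE /= sub0r opprK.
move=> /comb_pair_div [_ [w [_ _ yE]]].
rewrite -[h](subrK y); apply: subgroupD => //; first exact: multiples_subgroup.
by exists w.
Qed.

End AdicExtension.

Section Swap.
Variables (G H : zmodType) (I : choiceType).
Variables (Theta : set (G * H)) (Theta' : set (H * G)) (b : I -> G) (b' : I -> H).
Hypothesis swapTheta : forall t s, Theta (t, s) -> Theta' (s, t).

Lemma comb_pair_swap x y : comb_pair Theta b b' (x, y) -> comb_pair Theta' b' b (y, x).
Proof.
move=> [[t s] [r [c [Tts r_uniq c0]]]]; rewrite comb_pairE pairD => -[-> ->].
exists (s, t), r, c; split=> //; [exact: swapTheta | by rewrite comb_pairE].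
Qed.

Lemma adic_closure_swap p g h :
  adic_closure p Theta b b' (g, h) -> adic_closure p Theta' b' b (h, g).
Proof.
move=> Rgh n; have [x [y [Kxy gx hy]]] := Rgh n.
by exists y, x; split=> //; apply: comb_pair_swap.
Qed.

End Swap.

Definition adically_complete (p : nat) (H : zmodType) : Prop :=
  (forall h : H, (forall n, multiples H (p ^ n) h) -> h = 0) /\
  forall s : nat -> H, (forall n, multiples H (p ^ n) (s n.+1 - s n)) ->
    exists h, forall n, multiples H (p ^ n) (h - s n).

Definition basis_mod_torsion_plus_p (p : nat) (G : zmodType) (I : choiceType) (b : I -> G) : Prop :=
  (forall (r : seq I) (c : I -> int), uniq r ->
    (exists t h, torsion G t /\ \sum_(i <- r) b i *~ c i = t + h *+ p) ->
    forall i, i \in r -> (p %| c i)%Z) /\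
  forall g, exists (r : seq I) (c : I -> int) t h,
    [/\ uniq r, torsion G t & g = t + \sum_(i <- r) b i *~ c i + h *+ p].

(** The p-adic closure is the graph of the isomorphism; exchanging the two groups gives bijectivity
    from totality and uniqueness. *)
Lemma adic_group_iso (p : nat) (G H : zmodType) (I : choiceType)
    (Theta : set (G * H)) (b : I -> G) (b' : I -> H) :
  (0 < p)%N -> subgroup Theta ->
  (forall t s, Theta (t, s) -> torsion G t /\ torsion H s) ->
  (forall t, torsion G t -> exists s, Theta (t, s)) ->
  (forall s, torsion H s -> exists t, Theta (t, s)) ->
  (forall s, Theta (0, s) -> s = 0) -> (forall t, Theta (t, 0) -> t = 0) ->
  basis_mod_torsion_plus_p p b -> basis_mod_torsion_plus_p p b' ->
  adically_complete p G -> adically_complete p H -> group_iso G H.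
Proof.
move=> p_gt0 sTh Th_tor Th_l Th_r Th_l0 Th_r0 [b_free b_gen] [b'_free b'_gen].
move=> [G_sep G_complete] [H_sep H_complete].
pose Theta' := [set sy : H * G | Theta (sy.2, sy.1)].
have sTh' : subgroup Theta'.
  apply: subgroupP => [|[s t] [s' t'] Th Th']; first exact: (subgroup0 sTh).
  exact: (subgroupB sTh Th Th').
pose R := adic_closure p Theta b b'.
have sR : subgroup R by apply: adic_closure_subgroup.
have R_total g : exists h, R (g, h).
  apply: adic_closure_total => //; by move=> t s /Th_tor [].
have R_fun h : R (0, h) -> h = 0.
  apply: adic_closure_fun => //; by move=> t s /Th_tor [].
have R_total' h : exists g, R (g, h).
  have [|g] := @adic_closure_total p H G I Theta' b' b p_gt0 sTh' _ Th_r Th_r0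
    b'_free b'_gen G_complete h; first by move=> s t /Th_tor [].
  by move=> /(@adic_closure_swap _ _ _ _ Theta) Rg; exists g; apply: Rg.
have R_fun' g : R (g, 0) -> g = 0.
  move=> /(@adic_closure_swap _ _ _ _ Theta') Rg.
  apply: (@adic_closure_fun p H G I Theta' b' b) (Rg _) => //.
  by move=> s t /Th_tor [].
have R_uniq g h h' : R (g, h) -> R (g, h') -> h = h'.
  move=> Rh Rh'; apply/eqP; rewrite -subr_eq0; apply/eqP/R_fun.
  by have := subgroupB sR Rh Rh'; rewrite -[_ - _]/(_ - _, _ - _) /= subrr.
have R_uniq' g g' h : R (g, h) -> R (g', h) -> g = g'.
  move=> Rg Rg'; apply/eqP; rewrite -subr_eq0; apply/eqP/R_fun'.
  by have := subgroupB sR Rg Rg'; rewrite -[_ - _]/(_ - _, _ - _) /= subrr.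
have /choice[f fR] := R_total; have /choice[f' f'R] := R_total'.
have fB : zmod_morphism f.
  by move=> x y; apply: R_uniq (fR _) _; have := subgroupB sR (fR x) (fR y).
exists (HB.pack_for {additive G -> H} f (GRing.isZmodMorphism.Build G H f fB)).
exists f' => [g|h]; first exact: R_uniq' (f'R _) (fR g).
exact: R_uniq (fR _) (f'R h).
Qed.

Section PropGroup.
Variables (p : nat) (G : topologicalZmodType).
Hypotheses (p_pr : prime p) (hG : prop_group p G).

(** Separation: each character is killed by some p^k, so it vanishes on p^k G. Completeness: the
    conditions on the limit are closed because p^n G is, and [s L] satisfies the first L of them. *)
Lemma prop_group_adically_complete : adically_complete p G.
Proof.
have [cG hausG bG _] := hG; split=> [g gp|s sp].
  apply: contrapT => /(dual_separates p_pr hG) [a]; apply.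
  have [k ak] := dual_p_torsion hG a; have [h <-] := gp k.
  by rewrite evalMn -eval_natmul ak eval0.
have sM n := multiples_subgroup G (p ^ n).
apply: (compact_nested (F := fun n => [set h | multiples G (p ^ n) (h - s n)])) => // [n|L].
  apply: (@preimage_closed _ _ (fun g : G => g - s n) (multiples G (p ^ n))).
    by move=> g _; apply: translation_continuous.
  exact: (natmul_image_closed hG).
exists (s L) => i iL; rewrite /= -(subnKC (ltnW iL)).
elim: (L - i)%N => [|d IHd]; first by rewrite addn0 subrr; apply: subgroup0.
rewrite -[s (i + d.+1)%N](subrK (s (i + d)%N)) -addrA; apply: subgroupD => //.
by rewrite addnS; apply: multiples_exp_leq (sp _); apply: leq_addr.
Qed.

Hypothesis infexp : ~ finite_exponent (torsion G).

Lemma prop_group_continuum_basis :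
  exists b : (nat -> bool) -> G, basis_mod_torsion_plus_p p b.
Proof.
have [S [SC freeS genS]] := continuum_basis p_pr hG infexp.
have /card_bijP[u [u' uK u'K]] := card_esym SC.
pose b f : G := val (u (SigSub (mem_setT f))).
have b1 f : S (b f) by apply/set_mem/valP.
have b2 : injective b.
  by move=> f f' /val_inj /(can_inj uK) /(congr1 val).
have b3 x : S x -> exists f, b f = x.
  move=> Sx; exists (val (u' (SigSub (mem_set Sx)))); rewrite /b.
  set v := u' _; have -> : SigSub (mem_setT (val v)) = v by apply: val_inj.
  by rewrite u'K.
pose inv x := xget (fun=> false) [set f | b f = x].
have invK x : S x -> b (inv x) = x.
  move=> Sx; have [f fx] := b3 x Sx.
  exact: (@xgetI _ (fun=> false) [set f | b f = x] f).
have bK f : inv (b f) = f.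
  by apply: b2; rewrite invK.
exists b; split=> [r c r_uniq [t [h [Tt sumE]]] i ir|g].
  rewrite -(bK i); apply: (freeS (map b r) (c \o inv)) => /=.
  - by rewrite map_inj_uniq //; apply: can_inj bK.
  - by move=> x /mapP[f _ ->]; apply: b1.
  - by exists t, h; split=> //; rewrite -sumE big_map; apply: eq_bigr => f _; rewrite bK.
  - exact: map_f.
have [r [c [r_uniq rS [t [h [Tt gE]]]]]] := genS g.
exists (map inv r), (c \o b), t, h; split=> //.
  rewrite map_inj_in_uniq // => x y xr yr xy.
  by rewrite -(invK x (rS x xr)) xy invK //; apply: rS.
rewrite big_map addrAC -gE.
have -> : \sum_(x <- r) b (inv x) *~ (c \o b) (inv x) = \sum_(x <- r) x *~ c x.
  by apply: eq_big_seq => x xr /=; rewrite invK //; apply: rS.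
by rewrite subrK.
Qed.

End PropGroup.

Lemma torsion_closure_group_iso p (G : topologicalZmodType) :
  prime p -> prop_group p G -> ~ finite_exponent (torsion G) ->
  group_iso G (torsion_closure G).
Proof.
move=> p_pr hG infexp; have ht := prop_group_torsion_closure hG.
have infexp' : ~ finite_exponent (torsion (torsion_closure G)).
  by move=> /torsion_closure_finite_exponent.
have [b bP] := prop_group_continuum_basis p_pr hG infexp.
have [b' b'P] := prop_group_continuum_basis p_pr ht infexp'.
(* The graph of the identity between the torsion of [G] and that of its closure. *)
pose Theta := [set ts : G * torsion_closure G | torsion G ts.1 /\ val ts.2 = ts.1].
apply: (@adic_group_iso p _ _ _ Theta b b'); rewrite ?prime_gt0 //.
- apply: subgroupP => [|[t s] [t' s'] [/= Tt st] [/= Tt' st']].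
    by split=> //; apply: subgroup0 (torsion_subgroup G).
  split; first exact: (subgroupB (torsion_subgroup G) Tt Tt').
  by rewrite /= -st -st'.
- move=> t s [/= Tt st]; split=> //; apply/torsion_closure_torsion.
  by move: Tt; rewrite -st.
- by move=> t Tt; exists (SigSub (mem_set (subset_closure Tt))).
- by move=> s /torsion_closure_torsion Ts; exists (val s).
- by move=> s [_ /= s0]; apply: val_inj.
- by move=> t [_ /= <-].
- exact: prop_group_adically_complete.
- exact: prop_group_adically_complete.
Qed.

(* The multiplicity [alpha i] is that of the cyclic group of order
   [p ^ i.+1]: exponents start at 1 whereas the indices start at 0. *)
Theorem theorem3p1 (p : nat) (G : topologicalZmodType) (hp : prime p)
    (hG : pro_p p G) (hcb : countably_based G) :
  (finite_exponent (torsion G) ->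
     (subgroup (torsion G) /\ closed (torsion G)) /\
     exists (e : nat) (alpha : 'I_e -> countable_cardinal) (X : Type),
       (0 < e)%N /\
       topgroup_iso G
         (prod_topology (fun i : 'I_e =>
            {ptws cardinal_type (alpha i) -> cyclic_group (p ^ i.+1)})
          * {ptws X -> padic_int p})%type) /\
  (~ finite_exponent (torsion G) ->
     group_iso G (torsion_closure G) /\
     exists alpha : nat -> countable_cardinal,
       not_tending_to_0 alpha /\
       topgroup_iso (torsion_closure G)
         (prod_topology (fun i : nat =>
            {ptws cardinal_type (alpha i) -> cyclic_group (p ^ i.+1)}))).
Proof.
have hG' := pro_p_prop_group hG hcb.
split=> [|infexp]; first exact: prop_group_finite_exponent.
split; first exact: torsion_closure_group_iso hp hG' infexp.
apply: prop_group_dense_torsion hp (prop_group_torsion_closure hG') _ _.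
  exact: torsion_closure_dense.
by move=> /torsion_closure_finite_exponent.
Qed.
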